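(* For non-manifold simplicial complexes $\mathcal{K}$ of dimension $D$, the Min-Facet Component Algorithm in its version for non-manifold complexes (described in full in the context) gives (i) a $\frac{1}{D}$-factor approximation for the Max Morse Matching Problem if the $D$-interface of the Hasse graph of $\mathcal{K}$ is connected, i.e. its output has at least $\frac1D\,\mathrm{OPT}(\mathcal{K})$ regular simplices; (ii) a $\frac{1}{D+1}$-factor approximation if the $D$-interface is not connected, i.e. its output has at least $\frac{1}{D+1}\,\mathrm{OPT}(\mathcal{K})$ regular simplices.
   Context: For simplices $\tau,\sigma$ of a (finite) simplicial complex $\mathcal{K}$ write $\tau\prec\sigma$ ($\tau$ is a facet of $\sigma$, $\sigma$ a cofacet of $\tau$) if $\tau\subset\sigma$ and $\dim\tau=\dim\sigma-1$. The Hasse graph $H$ of $\mathcal{K}$ is the undirected graph whose vertices are the simplices of $\mathcal{K}$, with an edge between $\tau$ and $\sigma$ exactly when $\tau\prec\sigma$. The $d$-interface is the subgraph on the $d$-simplices and $(d-1)$-simplices with all edges between them. In an orientation, an edge $\tau\to\sigma$ with $\tau\prec\sigma$ is an up-edge and $\sigma\to\tau$ is a down-edge. The orientation induced by a matching $M$ makes the edges of $M$ up-edges and all others down-edges. $M$ is a Morse (acyclic) matching if this directed graph has no directed cycle. Simplices covered by $M$ are regular. The Max Morse Matching Problem asks for a Morse matching with the maximum number of regular simplices; this maximum is $\mathrm{OPT}(\mathcal{K})$. Frontier procedure on a subgraph $W$ of an interface. Compute a maximum-cardinality matching of $W$ and let $\overline{W}$ be the induced orientation. An up-edge from $\alpha$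 to $\beta$ is written $\chi(\alpha,\beta)$. A leading up-edge of $\chi_1(\alpha_1,\beta_1)$ is an up-edge $\chi_3(\alpha_2,\beta_2)$ such that $\beta_1\to\alpha_2$ is a down-edge. The facet-edges of $\beta$ are the edges between $\beta$ and its facets, with current orientations. While $\overline{W}$ contains an up-edge $\chi$, compute an edge set $C$ as follows, then move $C$ from $\overline{W}$ to the output. Start with $C=\emptyset$ and queue $\{\chi\}$. While the queue is nonempty, dequeue $\chi_0(\alpha_0,\beta_0)$ and add the facet-edges of $\beta_0$ to $C$; for every leading up-edge $\chi_i(\alpha_i,\beta_i)$ of $\chi_0$, if $C$ together with the facet-edges of $\beta_i$ has a cycle, reverse $\chi_i$ and add the facet-edges of $\beta_i$ to $C$, otherwise enqueue $\chi_i$. Finally add the remaining edges to the output. The up-edges of the output are the resulting matching. Procedure intermediateApx$(W,d)$. (1) Apply the frontier procedure to $W$. (2) For every unmatched $(d-1)$-simplex $\tau$ of $W$ all of whose cofacets in $W$ are also unmatched, match $\tau$ with one of these cofacets. (3) Make the matched pairs up-edges in the output orientation, and delete from the Hasse graph all simplices matched in this step and all critical (unmatched) $(d-1)$-simplices of $W$. Min-Facet Component Algorithm, version for non-manifold complexes. Start with all edges of the output orientation being down-edges. Process the interfaces in the order $d=1,\dots,D$, each time extracting the $d$-interface $G^d$ of the current Hasse graph (after all deletions so far). - $d=1$: apply the optimal algorithm to the graph whose vertices and edges are the $0$- and $1$-simplices. On a connected graph this is: choose an arbitrary start vertex, leave it critical, run a depth-first search, and whenever an unvisited vertex $w$ is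 reached from $v$ along an edge, match $w$ with that edge. Record the matched pairs as up-edges and delete from the Hasse graph the matched simplices and the critical $0$-simplices. - all remaining interfaces ($2\le d\le D$): while some $d$-simplex has at least one facet remaining in $G^d$, extract a min-facet component $F$ and apply intermediateApx$(F,d)$ (the deletions apply also to $G^d$). Here the facet degree of a $d$-simplex is its number of facets in the current $G^d$; a min-facet simplex is one whose facet degree is minimum among the $d$-simplices with at least one facet; a min-facet component is a maximal connected subgraph of $G^d$ induced by a set of min-facet simplices. The up-edges of the final orientation are the output Morse matching. *)

(* Defs.v *)
(* Simplices are nonempty sets of points of a finite type V. *)
From mathcomp Require Import all_boot all_order all_algebra.

Set Implicit Arguments.
Unset Strict Implicit.
Unset Printing Implicit Defensive.

(* The points of V that are not vertices of K play no role. *)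
Definition simplicial_complex (V : finType) (K : {set {set V}}) : Prop :=
  set0 \notin K /\
  forall s t : {set V}, s \in K -> t != set0 -> t \subset s -> t \in K.

Definition dim (V : finType) (s : {set V}) : nat := #|s|.-1.

Definition has_dim (V : finType) (K : {set {set V}}) (D : nat) : Prop :=
  (exists2 s, s \in K & dim s = D) /\ (forall s, s \in K -> dim s <= D).

Definition facet (V : finType) (t s : {set V}) : bool :=
  (t \subset s) && (dim s == (dim t).+1).

(* A Hasse edge is the pair (t, s) with t a facet of s.  A subgraph of the
   Hasse graph is given by its set of simplices (with all the edges between
   them) or by its set of edges. *)
Definition edge (V : finType) : Type := ({set V} * {set V})%type.

Definition edges (V : finType) (S : {set {set V}}) : {set edge V} :=
  [set e : edge V | [&& e.1 \in S, e.2 \in S & facet e.1 e.2]].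

Definition level (V : finType) (S : {set {set V}}) (d : nat) : {set {set V}} :=
  [set s in S | dim s == d].

Definition interface (V : finType) (S : {set {set V}}) (d : nat) :
  {set {set V}} :=
  [set s in S | (dim s == d) || ((dim s).+1 == d)].

Definition adjacent (V : finType) (S : {set {set V}}) : rel {set V} :=
  [rel x y | ((x, y) \in edges S) || ((y, x) \in edges S)].

Definition connected (V : finType) (S : {set {set V}}) : bool :=
  (S != set0) &&
  [forall x in S, forall y in S, connect (adjacent S) x y].

(* An orientation of a set E of Hasse edges is given by the set U of up-edges;
   the edges of E outside U are down-edges. *)
Definition darc (V : finType) (E U : {set edge V}) : rel {set V} :=
  [rel x y | ((x, y) \in E :&: U) || ((y, x) \in E :\: U)].

Definition has_dicycle (T : finType) (r : rel T) : bool :=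
  [exists x, exists y, r x y && connect r y x].

Lemma has_dicycleP (T : finType) (r : rel T) :
  reflect (exists2 c : seq T, c != [::] & ucycle r c) (has_dicycle r).
Proof.
apply: (iffP existsP) => [[x /existsP[y /andP[rxy /connectP[p rp xE]]]]|].
  case/shortenP: rp xE => q rq uq _ xE.
  exists (y :: q) => //; rewrite /ucycle uq andbT /=.
  by rewrite rcons_path rq -xE.
case=> [[//|x p] _ /andP[cxp _]]; exists x.
case: p cxp => [|y p] /=.
  by rewrite andbT => rxx; apply/existsP; exists x; rewrite rxx connect0.
case/andP=> rxy rp; apply/existsP; exists y; rewrite rxy /=.
by apply/connectP; exists (rcons p x); rewrite ?last_rcons.
Qed.

Definition ends (V : finType) (e : edge V) : {set {set V}} := [set e.1; e.2].

Definition regular (V : finType) (M : {set edge V}) : {set {set V}} :=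
  \bigcup_(e in M) ends e.

Definition matching (V : finType) (E M : {set edge V}) : bool :=
  (M \subset E) &&
  [forall e in M, forall f in M, (e != f) ==> [disjoint ends e & ends f]].

Definition morse_matching (V : finType) (K : {set {set V}})
  (M : {set edge V}) : bool :=
  matching (edges K) M && ~~ has_dicycle (darc (edges K) M).

Definition OPT (V : finType) (K : {set {set V}}) : nat :=
  \max_(M : {set edge V} | morse_matching K M) #|regular M|.

Definition maximum_matching (V : finType) (E M : {set edge V}) : bool :=
  matching E M &&
  [forall M' : {set edge V}, matching E M' ==> (#|M'| <= #|M|)].

Definition facet_edges (V : finType) (E : {set edge V}) (b : {set V}) :
  {set edge V} :=
  [set e in E | e.2 == b].

Definition leading_up_edges (V : finType) (E U : {set edge V}) (x : edge V) :
  {set edge V} :=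
  [set y in E :&: U | (y.1, x.2) \in E :\: U].

(* A state (U, C, q) holds the current up-edges, the collected edges, and the
   queue (dequeued at its head).  The orientation of an edge of C is always the
   current one, read off from U. *)
Definition bfs_state (V : finType) : Type :=
  ({set edge V} * {set edge V} * seq (edge V))%type.

Definition scan_edge (V : finType) (E : {set edge V}) (st : bfs_state V)
  (y : edge V) : bfs_state V :=
  let: (U, C, q) := st in
  let C' := C :|: facet_edges E y.2 in
  if has_dicycle (darc C' U) then (U :\ y, C', q) else (U, C, rcons q y).

(* The sequence s is the arbitrary order in which the leading up-edges of the
   dequeued x are examined.  Reversing one of them does not affect the status
   of the others, so they can be listed beforehand. *)
Inductive bfs (V : finType) (E : {set edge V}) :
  bfs_state V -> {set edge V} -> {set edge V} -> Prop :=
| bfs_stop (U C : {set edge V}) : bfs E (U, C, [::]) U C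
| bfs_dequeue (U C : {set edge V}) x q s U' C' :
    uniq s -> s =i leading_up_edges E U x ->
    bfs E (foldl (scan_edge E) (U, C :|: facet_edges E x.2, q) s) U' C' ->
    bfs E (U, C, x :: q) U' C'.

(* E and U are the edges and up-edges that are not yet output; the sets O and R
   are the up-edges of the output so far and of the final output. *)
Inductive frontier_loop (V : finType) :
  {set edge V} -> {set edge V} -> {set edge V} -> {set edge V} -> Prop :=
| frontier_stop (E O : {set edge V}) : frontier_loop E set0 O O
| frontier_step (E U O : {set edge V}) x U' C R :
    x \in U -> bfs E (U, set0, [:: x]) U' C ->
    frontier_loop (E :\: C) (U' :\: C) (O :|: (C :&: U')) R ->
    frontier_loop E U O R.

Definition frontier (V : finType) (E R : {set edge V}) : Prop :=
  exists2 U, maximum_matching E U & frontier_loop E U set0 R.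

(* In free, greedy, intermediate_apx and deleted, the subgraph W is given by its
   set X of simplices; the (d-1)-simplices of X are recognized by
   (dim t).+1 == d. *)
Definition free (V : finType) (X : {set {set V}}) (d : nat) (M : {set edge V})
  (t : {set V}) : bool :=
  [&& t \in X, (dim t).+1 == d, t \notin regular M &
      [forall s in X, facet t s ==> (s \notin regular M)]].

(* The simplices t are visited one after the other, against the matching
   updated so far; being matched is permanent, so a t that is not free when it
   is visited never becomes free again. *)
Inductive greedy (V : finType) (X : {set {set V}}) (d : nat) :
  {set edge V} -> {set edge V} -> Prop :=
| greedy_stop M :
    (forall t s, free X d M t -> s \in X -> ~~ facet t s) -> greedy X d M M
| greedy_step M t s M' :
    free X d M t -> s \in X -> facet t s ->
    greedy X d ((t, s) |: M) M' -> greedy X d M M'.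

Definition intermediate_apx (V : finType) (X : {set {set V}}) (d : nat)
  (M : {set edge V}) : Prop :=
  exists2 R, frontier (edges X) R & greedy X d R M.

Definition deleted (V : finType) (X : {set {set V}}) (d : nat)
  (M : {set edge V}) : {set {set V}} :=
  regular M :|: [set t in X | ((dim t).+1 == d) && (t \notin regular M)].

Definition facet_degree (V : finType) (S : {set {set V}}) (s : {set V}) : nat :=
  #|[set t in S | facet t s]|.

Definition min_facet_simplices (V : finType) (S : {set {set V}}) (d : nat) :
  {set {set V}} :=
  [set s in level S d | (0 < facet_degree S s) &&
    [forall s' in level S d,
       (0 < facet_degree S s') ==> (facet_degree S s <= facet_degree S s')]].

(* The subgraph induced by a set B of d-simplices contains the remaining
   facets of the members of B. *)
Definition induced (V : finType) (S B : {set {set V}}) : {set {set V}} :=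
  B :|: [set t in S | [exists s in B, facet t s]].

Definition min_facet_component (V : finType) (S : {set {set V}}) (d : nat)
  (F : {set {set V}}) : Prop :=
  exists2 B : {set {set V}},
    maxset (fun B : {set {set V}} =>
      (B \subset min_facet_simplices S d) && connected (induced S B)) B
    & F = induced S B.

(* S is the set of simplices left in the Hasse graph, M the current matching. *)
Inductive process (V : finType) (d : nat) :
  {set {set V}} -> {set edge V} -> {set {set V}} -> {set edge V} -> Prop :=
| process_stop S M :
    (forall s, s \in level S d -> facet_degree S s = 0) -> process d S M S M
| process_step S (M : {set edge V}) s F N S' M' :
    s \in level S d -> 0 < facet_degree S s ->
    min_facet_component S d F -> intermediate_apx F d N ->
    process d (S :\: deleted F d N) (M :|: N) S' M' ->
    process d S M S' M'.

(* Depth-first search of the graph of the 0- and 1-simplices of S, restarted in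
   each connected component.  dfs S A p M M': from the set A of visited
   vertices, the branch p being explored (current vertex first) and the pairs M
   matched so far, the search may end with the matching M'. *)
Inductive dfs (V : finType) (S : {set {set V}}) :
  {set {set V}} -> seq {set V} -> {set edge V} -> {set edge V} -> Prop :=
| dfs_stop (A : {set {set V}}) (M : {set edge V}) :
    level S 0 \subset A -> dfs S A [::] M M
| dfs_start (A : {set {set V}}) r M M' :
    r \in level S 0 -> r \notin A ->
    dfs S (r |: A) [:: r] M M' -> dfs S A [::] M M'
| dfs_visit (A : {set {set V}}) v p w e M M' :
    w \in level S 0 -> e \in level S 1 -> facet v e -> facet w e ->
    w \notin A ->
    dfs S (w |: A) [:: w, v & p] ((w, e) |: M) M' -> dfs S A (v :: p) M M'
| dfs_backtrack (A : {set {set V}}) v p M M' :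
    (forall w e, w \in level S 0 -> e \in level S 1 ->
       facet v e -> facet w e -> w \in A) ->
    dfs S A p M M' -> dfs S A (v :: p) M M'.

Definition process_interface (V : finType) (d : nat)
  (S : {set {set V}}) (M : {set edge V})
  (S' : {set {set V}}) (M' : {set edge V}) : Prop :=
  if d == 1 then
    exists2 N, dfs S set0 [::] set0 N &
      S' = S :\: deleted (interface S 1) 1 N /\ M' = M :|: N
  else process d S M S' M'.

Inductive process_interfaces (V : finType) :
  seq nat -> {set {set V}} -> {set edge V} -> {set edge V} -> Prop :=
| interfaces_stop S M : process_interfaces [::] S M M
| interfaces_step d ds S M S1 M1 M' :
    process_interface d S M S1 M1 -> process_interfaces ds S1 M1 M' ->
    process_interfaces (d :: ds) S M M'.

(* M is a possible output of the (nondeterministic) algorithm. *)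
Definition min_facet_algorithm (V : finType) (K : {set {set V}}) (D : nat)
  (M : {set edge V}) : Prop :=
  process_interfaces (iota 1 D) K set0 M.

(* Main.v *)
(** Write m_d and n_d for the numbers of pairs with upper end of dimension d, in
    the output and in an arbitrary Morse matching N.  Step (2) of the
    intermediate procedure makes every (d-1)-simplex of a component a facet of
    some matched d-simplex, so each (d-1)-simplex with a cofacet is either
    matched downwards or one of the at most d+1 facets of a matched d-simplex:
    n_d <= (d+1) m_d + m_(d-1).  Summing over d gives |N| <= (D+1) |M|; the
    frontier procedure matters only for acyclicity.
    If the D-interface is connected and D >= 2, some (D-1)-simplex is already
    matched downwards when the D-interface is reached, and connectedness keeps
    the minimum facet degree at most D from then on.  Hence
    n_(D-1) + n_D <= #((D-1)-simplices) <= m_(D-1) + D m_D, and together with the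
    previous bound in dimensions below D-1 this yields |N| <= D |M|.  For D = 1
    the search tree spans the graph.
    Acyclicity is witnessed by a rank on the pairs that decreases from x to y
    whenever the lower end of y is a facet of the upper end of x; pairs added
    later get larger ranks, as no earlier pair leads to them. *)
From mathcomp Require Import all_boot all_order all_algebra.
From mathcomp Require Import zify.
Require Import Defs.

Import Order.TTheory GRing.Theory Num.Theory.

Set Implicit Arguments.
Unset Strict Implicit.
Unset Printing Implicit Defensive.

(** * Acyclic relations and ranked matchings *)

Section Acyclic.
Variable (T : finType) (r : rel T).

Lemma no_dicycle_descending (f : T -> nat) :
  (forall x y, r x y -> f y < f x) -> ~~ has_dicycle r.
Proof.
move=> fr; have fc x y : connect r x y -> f y <= f x.
  case/connectP=> p; elim: p x => [|z p IHp] x /=; first by move=> _ ->.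
  by case/andP=> /fr fzx rp yE; exact: leq_trans (IHp z rp yE) (ltnW fzx).
apply/existsP=> [[x /existsP[y /andP[/fr fyx /fc]]]].
by rewrite leqNgt fyx.
Qed.

(** Whatever [y] reaches, [x] reaches too, but [y] does not reach [x], since the arc would close a
    cycle. The number of reachable points is thus a potential. *)
Lemma reach_strict x y :
  ~~ has_dicycle r -> r x y -> #|connect r y| < #|connect r x|.
Proof.
move=> nr rxy; apply/proper_card/properP; split.
  by apply/subsetP=> z; exact: connect_trans (connect1 rxy).
exists x; first exact: connect0.
apply: contra nr => yx; apply/existsP; exists x; apply/existsP; exists y.
by rewrite rxy.
Qed.

(** Later acyclicity arguments work on such a potential [f], changing its value at a few simplices
    instead of handling cycles. *)
Lemma no_dicycleP :
  reflect (exists f : T -> nat, forall x y, r x y -> f y < f x)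
    (~~ has_dicycle r).
Proof.
apply: (iffP idP) => [nr|[f]]; last exact: no_dicycle_descending.
by exists (fun x => #|connect r x|) => x y; exact: reach_strict.
Qed.

End Acyclic.

(** * Matchings and the simplices they cover *)

Section Matching.
Variable V : finType.
Implicit Types (E M N U : {set edge V}) (x y e : edge V) (s t : {set V}).

Lemma facet_dim t s : facet t s -> dim s = (dim t).+1.
Proof. by case/andP=> _ /eqP. Qed.

Lemma mem_edges (S : {set {set V}}) e :
  (e \in edges S) = [&& e.1 \in S, e.2 \in S & facet e.1 e.2].
Proof. by rewrite inE. Qed.

Lemma regularP M s :
  reflect (exists2 x, x \in M & s = x.1 \/ s = x.2) (s \in regular M).
Proof.
apply: (iffP bigcupP) => [[x xM sx]|[x xM sx]]; exists x => //.
  by move: sx; rewrite /ends !inE => /orP[]/eqP; auto.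
by rewrite /ends !inE; case: sx => ->; rewrite eqxx ?orbT.
Qed.

Lemma regular1 M x : x \in M -> x.1 \in regular M.
Proof. by move=> xM; apply/regularP; exists x; auto. Qed.

Lemma regular2 M x : x \in M -> x.2 \in regular M.
Proof. by move=> xM; apply/regularP; exists x; auto. Qed.

Lemma regular0 : regular (set0 : {set edge V}) = set0.
Proof. by rewrite /regular big_set0. Qed.

Lemma matchingP E M :
  reflect (M \subset E /\ forall x y, x \in M -> y \in M ->
             [\/ x.1 = y.1, x.1 = y.2, x.2 = y.1 | x.2 = y.2] -> x = y)
    (matching E M).
Proof.
apply: (iffP andP) => [] [ME H]; split=> //.
  move=> x y xM yM xy; apply/eqP/negPn/negP=> nxy.
  have := forall_inP (forall_inP H x xM) y yM; rewrite nxy /=.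
  move/disjoint_setI0/setP=> H0.
  by case: xy => E0; [have := H0 x.1 | have := H0 x.1 | have := H0 x.2
    | have := H0 x.2]; rewrite !inE -?E0 !eqxx ?orbT.
apply/forall_inP=> x xM; apply/forall_inP=> y yM; apply/implyP=> nxy.
apply/pred0Pn=> [[z /=]]; rewrite /ends !inE => /andP[zx zy].
case/negP: nxy; apply/eqP; apply: H => //.
case/orP: zx => /eqP<-; case/orP: zy => /eqP<-;
  by [constructor 1 | constructor 2 | constructor 3 | constructor 4].
Qed.

Lemma matching_sub E M N : matching E M -> N \subset M -> matching E N.
Proof.
case/matchingP=> ME H NM; apply/matchingP; split.
  exact: subset_trans NM ME.
by move=> x y /(subsetP NM) xM /(subsetP NM) yM; exact: H.
Qed.

Lemma matching_mono E E' M : matching E M -> E \subset E' -> matching E' M.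
Proof.
by case/matchingP=> ME H EE; apply/matchingP; split=> //; exact: subset_trans EE.
Qed.

Lemma matching0 E : matching E set0.
Proof. by apply/matchingP; split=> [|x y]; rewrite ?sub0set ?inE. Qed.

Lemma matchingU E M N : matching E M -> matching E N ->
  (forall s, s \in regular M -> s \in regular N -> False) ->
  matching E (M :|: N).
Proof.
case/matchingP=> ME HM /matchingP[NE HN] dis; apply/matchingP; split.
  by rewrite subUset ME.
have aux x y : x \in M -> y \in N ->
    [\/ x.1 = y.1, x.1 = y.2, x.2 = y.1 | x.2 = y.2] -> False.
  move=> xM yN; have [h1 h2 h3 h4]:= And4 (regular1 xM) (regular2 xM)
    (regular1 yN) (regular2 yN).
  by case=> E0; [move: h1 h3 | move: h1 h4 | move: h2 h3 | move: h2 h4];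
    rewrite E0; exact: dis.
move=> x y; rewrite !inE => /orP[]xM /orP[]yM xy; try by auto.
  by case: (aux x y).
by case: (aux y x) => //; case: xy => ->;
  [constructor 1 | constructor 3 | constructor 2 | constructor 4].
Qed.

Lemma card_regular E M :
  matching E M -> (forall x, x \in M -> x.1 != x.2) ->
  #|regular M| = (#|M| * 2)%N.
Proof.
case/matchingP=> _ H ne.
have -> : regular M = [set x.1 | x in M] :|: [set x.2 | x in M].
  apply/setP=> s; apply/regularP/setUP=> [[x xM []->]|].
  - by left; apply: imset_f.
  - by right; apply: imset_f.
  - by case=> /imsetP[x xM ->]; exists x; auto.
rewrite cardsU (_ : _ :&: _ = set0) ?cards0 ?subn0.
  rewrite !card_in_imset ?muln2 ?addnn // => x y xM yM xy; apply: H => //.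
    by constructor 4.
  by constructor 1.
apply/setP=> s; rewrite !inE; apply/andP=> [[/imsetP[x xM ->]]].
case/imsetP=> y yM xy.
by have := ne x xM; rewrite {2}(H x y xM yM) ?xy ?eqxx //; constructor 2.
Qed.

End Matching.

(** * Ranks on pairs and acyclicity of the induced orientation *)

Section Gradient.
Variable V : finType.
Implicit Types (E M N U : {set edge V}) (x y e : edge V) (s t : {set V}).

(** A rank acts as a discrete Morse function on the pairs, dropping at each step of a gradient path.
    It refers to all facets and not to an edge set, so it carries over from a subgraph to the whole
    Hasse graph. *)
Definition ranked M := exists r : edge V -> nat,
  forall x y, x \in M -> y \in M -> x != y -> facet y.1 x.2 -> r y < r x.

Lemma ranked0 : ranked set0.
Proof. by exists (fun _ => 0) => x y; rewrite inE. Qed.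

Lemma ranked1 x : ranked [set x].
Proof.
by exists (fun _ => 0) => y z /set1P-> /set1P->; rewrite eqxx.
Qed.

(** The ranks of the new pairs are shifted above the maximum rank on [M]; the third hypothesis
    excludes steps from [M] up to [N]. *)
Lemma rankedU M N : ranked M -> ranked N ->
  (forall x y, x \in M -> y \in N -> ~~ facet y.1 x.2) -> ranked (M :|: N).
Proof.
case=> r Hr [r' Hr'] MN; pose B := \max_(x in M) r x.
have rB x : x \in M -> r x <= B by move=> xM; rewrite /B (bigD1 x) //= leq_maxl.
exists (fun x => if x \in M then r x else B.+1 + r' x) => x y.
rewrite !inE; case: (boolP (x \in M)) => xM /=.
  move=> _; case: (boolP (y \in M)) => [yM _|yM /= yN _ F]; first exact: Hr.
  by case/negP: (MN _ _ xM yN).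
move=> xN; case: (boolP (y \in M)) => [yM _ _ _|yM /= yN xy F].
  by have := rB _ yM; lia.
by rewrite ltn_add2l; exact: Hr'.
Qed.

(* A directed cycle alternates between two consecutive dimensions: the quantity
   [dim z + (z is the lower end of a pair of M)] never increases along an arc,
   and while it stays constant the rank of the current pair decreases. *)
Lemma ranked_no_dicycle E M :
  matching E M -> (forall x, x \in E -> facet x.1 x.2) -> ranked M ->
  ~~ has_dicycle (darc E M).
Proof.
case/matchingP=> ME HM Ef [r Hr].
have {}Hr x y : x \in M -> y \in M -> y.1 != x.1 -> facet y.1 x.2 -> r y < r x.
  by move=> xM yM n; apply: Hr => //; apply: contraNneq n => ->.
pose lo z := [pick x in M | x.1 == z].
pose up z := [pick x in M | x.2 == z].
have loE x : x \in M -> lo x.1 = Some x.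
  move=> xM; rewrite /lo; case: pickP => [y /andP[yM /eqP yx]|/(_ x)].
    by congr Some; apply: HM => //; constructor 1.
  by rewrite xM eqxx.
have upE x : x \in M -> up x.2 = Some x.
  move=> xM; rewrite /up; case: pickP => [y /andP[yM /eqP yx]|/(_ x)].
    by congr Some; apply: HM => //; constructor 4.
  by rewrite xM eqxx.
have lo2 x : x \in M -> lo x.2 = None.
  move=> xM; rewrite /lo; case: pickP => // y /andP[yM /eqP yx].
  have yxe : y = x by apply: HM => //; constructor 2.
  by have := facet_dim (Ef _ (subsetP ME _ xM)); rewrite -yx yxe => /n_Sn.
have loP z x : lo z = Some x -> x \in M /\ x.1 = z.
  by rewrite /lo; case: pickP => // y /andP[yM /eqP yx] [<-].
have upP z x : up z = Some x -> x \in M /\ x.2 = z.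
  by rewrite /up; case: pickP => // y /andP[yM /eqP yx] [<-].
pose R := \max_(x in M) r x.
have rR x : x \in M -> r x <= R by move=> xM; rewrite /R (bigD1 x) //= leq_maxl.
(* Lower ends get odd values and upper ends even ones, so that climbing a pair loses one and
   descending into a pair of smaller rank also loses. A simplex in no pair gets a value above all of
   these. *)
pose phi z := if lo z is Some x then (r x).*2.+1
  else if up z is Some x then (r x).*2 else R.*2.+2.
have phiR z : phi z <= R.*2.+2.
  rewrite /phi; case El: (lo z) => [x|]; last case Eu: (up z) => [x|] //.
    by have [/rR] := loP _ _ El; lia.
  by have [/rR] := upP _ _ Eu; lia.
apply: (@no_dicycle_descending _ _
  (fun z => (dim z + (lo z != None)) * R.*2.+3 + phi z)) => a b.
case/orP; rewrite inE => /andP[].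
  move=> abE abM; have /facet_dim /= dab := Ef _ abE.
  have /= lb := lo2 _ abM; have /= la := loE _ abM; have /= ub := upE _ abM.
  by rewrite /phi la lb ub dab /=; lia.
move=> nM baE; have fba := Ef _ baE; have /facet_dim /= dba := fba.
case lb: (lo b) => [y|]; last first.
  rewrite /= dba; suff: phi b < R.*2.+3 + phi a by case: (lo a); lia.
  by have := phiR b; lia.
case la: (lo a) => [x|].
  by rewrite dba /=; have := phiR b; lia.
rewrite dba /= addn0 addn1 ltn_add2l /phi la lb.
have [yM yb] := loP _ _ lb.
case ua: (up a) => [x|]; last by have := rR _ yM; lia.
have [xM xa] := upP _ _ ua; suff: r y < r x by lia.
apply: Hr => //; last by rewrite yb xa.
rewrite yb; apply: contraNneq nM => bx.
by rewrite bx -xa -surjective_pairing.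
Qed.

(** No pair of [M] leads to [t], so the new pair can be ranked on top. *)
Lemma matching_ranked_add E M t s :
  matching E M -> ranked M -> (t, s) \in E -> t != s ->
  t \notin regular M -> s \notin regular M ->
  (forall x, x \in M -> ~~ facet t x.2) ->
  matching E ((t, s) |: M) /\ ranked ((t, s) |: M).
Proof.
move=> mM rM tsE nts tM sM lead; rewrite setUC; split; last first.
  by apply: rankedU => // [|x y xM /set1P->]; [exact: ranked1 | exact: lead].
apply: matchingU => //.
  apply/matchingP; split; first by rewrite sub1set.
  by move=> x y /set1P-> /set1P->.
move=> z zM /regularP[x /set1P->] /= [] E0; move: zM; rewrite E0.
  by rewrite (negPf tM).
by rewrite (negPf sM).
Qed.

End Gradient.

(** * The frontier procedure *)

Section Frontier.
Variables (V : finType) (E : {set edge V}).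
Implicit Types (C U : {set edge V}) (x y e : edge V) (q s : seq (edge V)).

Hypothesis bipartite : forall e e', e \in E -> e' \in E -> e.1 != e'.2.

(** These are the unions of complete sets of facet-edges, the only form that the collected set of
    the search takes. *)
Definition facet_closed C :=
  C \subset E /\
  forall e e', e \in C -> e' \in E -> e'.2 = e.2 -> e' \in C.

Lemma facet_closed0 : facet_closed set0.
Proof. by split=> [|e e']; rewrite ?sub0set ?inE. Qed.

Lemma facet_closedU C x :
  facet_closed C -> facet_closed (C :|: facet_edges E x.2).
Proof.
case=> CE HC; split.
  by rewrite subUset CE; apply/subsetP=> e; rewrite inE => /andP[].
move=> e e'; rewrite !inE => /orP[eC|/andP[eE /eqP->]] e'E e2.
  by rewrite (HC e).
by rewrite e'E e2 eqxx orbT.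
Qed.

Lemma facet_edges_mem x : x \in E -> x \in facet_edges E x.2.
Proof. by move=> xE; rewrite inE xE eqxx. Qed.

Lemma dicycle_mono (C C' U : {set edge V}) : C \subset C' ->
  ~~ has_dicycle (darc C' U) -> ~~ has_dicycle (darc C U).
Proof.
move=> /subsetP CC /no_dicycleP[f Hf]; apply: (@no_dicycle_descending _ _ f).
move=> a b ab; apply: Hf; move: ab; rewrite /darc /= !inE.
by case/orP=> /andP[] => [/CC-> ->|-> /CC->]; rewrite ?orbT.
Qed.

Variable U0 : {set edge V}.
Hypothesis U0_matching : matching E U0.

Let U0E : U0 \subset E. Proof. by case/matchingP: U0_matching. Qed.

Let U0_inj x y : x \in U0 -> y \in U0 -> x.2 = y.2 -> x = y.
Proof.
by move=> xU yU xy; case/matchingP: U0_matching => _; apply=> //; constructor 4.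
Qed.

(** Once [y] is reversed, no up-edge enters [y.2], which becomes a source; giving it the largest
    potential keeps the orientation acyclic. *)
Lemma dicycle_reverse C U y : C \subset E -> U \subset U0 -> y \in U0 ->
  ~~ has_dicycle (darc C U) ->
  ~~ has_dicycle (darc (C :|: facet_edges E y.2) (U :\ y)).
Proof.
move=> /subsetP CE /subsetP UU0 yU0 /no_dicycleP[f Hf].
have yE := subsetP U0E _ yU0.
apply: (@no_dicycle_descending _ _
  (fun z => if z == y.2 then (\max_z f z).+1 else f z)) => a b.
have fm z : f z < (\max_z f z).+1 by rewrite ltnS (bigD1 z) //= leq_maxl.
case/orP; rewrite !inE.
  case/andP=> abC /andP[aby abU].
  have abE := subsetP U0E _ (UU0 _ abU).
  have by2 : b != y.2.
    by apply: contraNneq aby => by2; apply/eqP/U0_inj => //; exact: UU0.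
  move: abC; rewrite abE (negPf by2) orbF => abC.
  rewrite (negPf (bipartite abE yE)) /=.
  by apply: Hf; rewrite /darc /= !inE abC abU.
case/andP=> nab abC; have baE : (b, a) \in E.
  by case/orP: abC => [/CE|/andP[]].
have /= /negPf-> := bipartite baE yE.
case: eqP => [//|/eqP nay].
move: abC; rewrite baE (negPf nay) orbF => abC.
apply: Hf; rewrite /darc /= !inE abC.
move: nab; rewrite negb_and negbK => /orP[/eqP ya|->]; rewrite ?orbT //.
by case/eqP: nay; rewrite -ya.
Qed.

(** Without leading up-edges, every facet reached from [y.2] by a down-edge is a sink, so no cycle
    passes through [y.2]. The potential is 0 on these sinks, 1 at [y.2], and shifted by two
    elsewhere. *)
Lemma dicycle_no_leading C U y : C \subset E -> U \subset U0 -> y \in E ->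
  leading_up_edges E U y = set0 ->
  ~~ has_dicycle (darc (C :\: facet_edges E y.2) U) ->
  ~~ has_dicycle (darc C U).
Proof.
move=> /subsetP CE UU0 yE /setP L0 /no_dicycleP[f Hf].
have UE := subsetP (subset_trans UU0 U0E).
apply: (@no_dicycle_descending _ _
  (fun z => if z == y.2 then 1
            else if (z, y.2) \in E :\: U then 0 else (f z).+2)) => a b.
case/orP; rewrite inE => /andP[].
  move=> abC abU; have abE := UE _ abU.
  rewrite (negPf (bipartite abE yE)) /=.
  have -> : ((b, y.2) \in E :\: U) = false.
    apply/negP; rewrite inE => /andP[_ byE].
    by have := bipartite byE abE; rewrite eqxx.
  case: (boolP (b == y.2)) => [/eqP by2|by2].
    by rewrite -by2 !inE abU.
  have -> : ((a, y.2) \in E :\: U) = false.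
    by have := L0 (a, b); rewrite !inE abU abE /=.
  by rewrite !ltnS; apply: Hf; rewrite /darc /= !inE abU abC (negPf by2) /= andbF.
move=> baU baC; have baE := CE _ baC.
have /negPf /= -> := bipartite baE yE.
have /negPf -> : (a, y.2) \notin E :\: U.
  rewrite inE negb_and; apply/orP; right; apply/negP=> ayE.
  by have := bipartite ayE baE; rewrite eqxx.
case: (boolP (a == y.2)) => [/eqP ay2|ay2]; first by rewrite -ay2 !inE baU baE.
case: (_ \in _) => //; rewrite !ltnS.
by apply: Hf; rewrite /darc /= !inE baU baC (negPf ay2) /= andbF orbT.
Qed.

(* While the leading up-edges s of the dequeued x remain to be scanned, C may
   have cycles, but all of them pass through the head of x. *)
Definition scan_ok (x : edge V) s (st : bfs_state V) :=
  let: (U, C, q) := st in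
  [/\ facet_closed C, U \subset U0, {subset q <= U0},
      forall z y, z \in C :&: U -> y \in leading_up_edges E U z ->
        [\/ y \in C, y \in q | z = x /\ y \in s] &
      ~~ has_dicycle (darc C U) \/
      ~~ has_dicycle (darc (C :\: facet_edges E x.2) U) /\
      {subset leading_up_edges E U x <= s}].

(** By the fourth clause, once the queue is empty no collected up-edge leads to an up-edge left
    behind. Pairs output later can therefore be ranked above the collected ones. *)
Definition bfs_ok (st : bfs_state V) :=
  let: (U, C, q) := st in
  [/\ facet_closed C, U \subset U0, {subset q <= U0},
      forall z y, z \in C :&: U -> y \in leading_up_edges E U z ->
        y \in C \/ y \in q &
      ~~ has_dicycle (darc C U)].

(** A reversal creates down-edges but no new leading up-edge: the facet below a reversed edge had
    that edge as its only up-edge. *)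
Lemma leading_sub U U' x : U' \subset U -> U \subset U0 ->
  leading_up_edges E U' x \subset leading_up_edges E U x.
Proof.
move=> /subsetP UU /subsetP UU0; apply/subsetP=> y.
rewrite !inE => /andP[/andP[yE yU'] /andP[nyx yxE]].
rewrite yE yxE (UU _ yU') !andbT /=; apply: contra nyx => yxU.
suff -> : (y.1, x.2) = y by [].
case/matchingP: U0_matching => _; apply; [exact: UU0|exact/UU0/UU|].
by constructor 1.
Qed.

(** A negative cycle test covers a set containing [C] and so certifies [C] itself acyclic. After a
    positive test the reversed [y] is no longer a leading up-edge of [x], and its upper end is a
    source. *)
Lemma scan_step x y s st : y \in U0 ->
  scan_ok x (y :: s) st -> scan_ok x s (scan_edge E st y).
Proof.
case: st => [[U C] q] yU0 [Cc UU0 qU0 cov dic] /=.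
have CE : C \subset E by case: Cc.
case: ifPn => [_|nd]; split=> //.
- exact: facet_closedU.
- exact: subset_trans (subsetDl _ _) UU0.
- move=> z w zCU wL; move: zCU; rewrite !inE => /andP[zC /andP[zy zU]].
  have := subsetP (leading_sub z (subsetDl U [set y]) UU0) w wL.
  have {}zC : z \in C.
    case/orP: zC => // /andP[_ /eqP zy2]; case/eqP: zy.
    by apply: U0_inj => //; exact: (subsetP UU0).
  have wy : w != y by move: wL; rewrite !inE => /andP[/andP[_ /andP[]]].
  case/cov; first by rewrite inE zC.
  + by move=> wC; constructor 1; rewrite wC.
  + by constructor 2.
  + by case=> zx; rewrite inE (negPf wy) /=; constructor 3.
- case: dic => [dic|[dic L]]; [left|right]; first exact: dicycle_reverse.
  split.
    have CxE : C :\: facet_edges E x.2 \subset E.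
      exact: subset_trans (subsetDl _ _) CE.
    apply: dicycle_mono (dicycle_reverse CxE UU0 yU0 dic).
    by rewrite setDUl setUS ?subsetDl.
  move=> w wL; have := L _ (subsetP (leading_sub x (subsetDl U [set y]) UU0) w wL).
  rewrite inE => /predU1P[wy|//]; move: wL.
  by rewrite !inE wy eqxx /= !andbF.
- by move=> z; rewrite mem_rcons => /predU1P[->|/qU0].
- move=> z w zCU /(cov _ _ zCU)[]; [by constructor 1| |].
    by rewrite mem_rcons inE => ->; rewrite orbT; constructor 2.
  case=> zx; rewrite inE mem_rcons inE => /predU1P[->|ws].
    by rewrite eqxx; constructor 2.
  by constructor 3.
- by left; apply: dicycle_mono nd; exact: subsetUl.
Qed.

(** After the scan, either [C] is already acyclic or [x] has no leading up-edge left, and then its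
    head lies on no cycle. *)
Lemma scan_all x s st : x \in E -> {subset s <= U0} ->
  scan_ok x s st -> bfs_ok (foldl (scan_edge E) st s).
Proof.
move=> xE; elim: s st => [|y s IHs] st sU0 /=; last first.
  move=> ok; apply: IHs; last by apply: scan_step ok; rewrite sU0 ?mem_head.
  by move=> z zs; rewrite sU0 // inE zs orbT.
case: st => [[U C] q] [Cc UU0 qU0 cov dic]; split=> //.
  by move=> z y zCU /(cov z y zCU)[|| []]; auto.
case: dic => // [[dic L]]; apply: dicycle_no_leading dic => //.
  by case: Cc.
by apply/setP=> z; rewrite [RHS]inE; apply/negP=> /L.
Qed.

Lemma dequeue U C x q s : bfs_ok (U, C, x :: q) ->
  s =i leading_up_edges E U x ->
  bfs_ok (foldl (scan_edge E) (U, C :|: facet_edges E x.2, q) s).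
Proof.
case=> Cc UU0 qU0 cov dic sL.
have xU0 : x \in U0 by rewrite qU0 ?mem_head.
have xE : x \in E by exact: (subsetP U0E).
apply: (@scan_all x) => //.
  by move=> y; rewrite sL !inE => /andP[/andP[_ /(subsetP UU0)]].
split=> //.
- exact: facet_closedU.
- by move=> z zq; rewrite qU0 // inE zq orbT.
- move=> z y zCU yL; move: zCU.
  rewrite !inE => /andP[/orP[zC|/andP[zE /eqP zx]] zU].
    case: (cov z y) => //; first by rewrite inE zC.
      by move=> yC; constructor 1; rewrite yC.
    rewrite inE => /predU1P[->|]; last by constructor 2.
    by constructor 1; rewrite xE eqxx orbT.
  constructor 3; have zxe : z = x by apply: U0_inj => //; exact: (subsetP UU0).
  by rewrite sL -zxe.
(* The old [C] was acyclic, so a new cycle must use the facet-edges just added. *)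
- right; split; last by move=> y; rewrite sL.
  apply: dicycle_mono dic; rewrite setDUl setDv setU0; exact: subsetDl.
Qed.

Lemma scan_mono s st :
  (foldl (scan_edge E) st s).1.1 \subset st.1.1 /\
  st.1.2 \subset (foldl (scan_edge E) st s).1.2 /\
  {subset st.2 <= (foldl (scan_edge E) st s).2}.
Proof.
elim: s st => [|y s IHs] [[U C] q] /=; first by split=> //; split.
case: ifP => _.
  have [/= h1 [h2 h3]] := IHs (U :\ y, C :|: facet_edges E y.2, q).
  split; first exact: subset_trans h1 (subsetDl _ _).
  by split=> //; apply: subset_trans h2; exact: subsetUl.
have [/= h1 [h2 h3]] := IHs (U, C, rcons q y); split=> //; split=> //.
by move=> z zq; apply: h3; rewrite mem_rcons inE zq orbT.
Qed.

Lemma scan_progress s U C q : {subset s <= U} ->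
  let: st := foldl (scan_edge E) (U, C, q) s in
  st = (U, C, q ++ s) \/ #|st.1.1| < #|U|.
Proof.
elim: s q => [|y s IHs] q sU /=; first by left; rewrite cats0.
have yU : y \in U by rewrite sU ?mem_head.
case: ifP => _.
  right; have [h _] := scan_mono s (U :\ y, C :|: facet_edges E y.2, q).
  by apply: leq_ltn_trans (subset_leq_card h) _; rewrite [ltnRHS](cardsD1 y) yU.
by rewrite -cat_rcons; apply: IHs => z zs; rewrite sU // inE zs orbT.
Qed.

Lemma bfs_sound st U C : bfs E st U C -> bfs_ok st ->
  [/\ bfs_ok (U, C, [::]), U \subset st.1.1 & 
      forall x, x \in st.1.2 \/ x \in st.2 -> x \in C].
Proof.
elim=> [{}U {}C|{}U {}C x q s U' C' _ sL _ IH] ok.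
  by split=> // x [].
have [ok' /= UU Cq] := IH (dequeue ok sL).
have [h1 [h2 h3]] := scan_mono s (U, C :|: facet_edges E x.2, q).
split=> //; first exact: subset_trans h1.
have xE : x \in E.
  by case: ok => _ _ qU0 _ _; rewrite (subsetP U0E) // qU0 ?mem_head.
move=> z [zC|]; first by apply: Cq; left; apply: (subsetP h2); rewrite inE zC.
rewrite inE => /predU1P[->|zq]; last by apply: Cq; right; exact: h3.
apply: Cq; left; apply: (subsetP h2).
by rewrite inE facet_edges_mem ?orbT.
Qed.

(* Queued edges need not be distinct, and an edge may be enqueued after it has
   been dequeued.  Once U and C are stable, the leading up-edges of x in C are
   strictly below x in the acyclic orientation of C, so replacing x by them in the
   queue decreases the total weight. *)
Let w (U C : {set edge V}) (y : edge V) : nat :=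
  if y \in C then #|{: edge V}|.+1 ^ #|connect (darc C U) y.2|.+1 else 1.

Lemma leading_weight U C x s : facet_closed C -> ~~ has_dicycle (darc C U) ->
  x \in C -> uniq s -> s =i leading_up_edges E U x ->
  \sum_(y <- s) w U C y < w U C x.
Proof.
case=> _ HC nd xC us sL; rewrite {2}/w xC.
set n := #|{: edge V}|; set k := #|connect _ _|.
have wle y : y \in s -> w U C y <= n.+1 ^ k.
  rewrite sL !inE => /andP[/andP[yE yU] /andP[nyx yxE]].
  rewrite /w; case: ifP => yC; last by rewrite expn_gt0.
  rewrite leq_pexp2l //.
  have yxC : (y.1, x.2) \in C by exact: (HC x).
  apply: ltn_trans (reach_strict (y := y.1) nd _).
    apply: reach_strict => //.
    by rewrite /darc /= !inE -surjective_pairing yC yU.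
  by rewrite /darc /= !inE yxC nyx orbT.
apply: (@leq_ltn_trans (\sum_(y <- s) n.+1 ^ k)).
  by rewrite !big_seq; apply: leq_sum.
rewrite big_const_seq count_predT iter_addn_0 expnS mulnC ltn_pmul2r ?expn_gt0 //.
by rewrite ltnS -(card_uniqP us) max_card.
Qed.

(** The termination measure is lexicographic. A reversal shrinks [U], dequeuing an edge outside [C]
    enlarges [C], and in the remaining case [U] and [C] are unchanged while the queue loses
    weight. *)
Lemma bfs_total st : bfs_ok st -> exists U C, bfs E st U C.
Proof.
have [a] := ubnP (#|st.1.1| + #|E :\: st.1.2|).
elim: a st => // a IHa st.
have [b] := ubnP (\sum_(y <- st.2) w st.1.1 st.1.2 y).
elim: b st => // b IHb [[U C] [|x q]] /= lb la ok.
  by exists U, C; constructor.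
pose s := enum (leading_up_edges E U x).
have sL : s =i leading_up_edges E U x by move=> z; rewrite mem_enum.
have us : uniq s := enum_uniq _.
have ok' := dequeue ok sL.
suff [U' [C' H]] : exists U' C',
    bfs E (foldl (scan_edge E) (U, C :|: facet_edges E x.2, q) s) U' C'.
  by exists U', C'; exact: bfs_dequeue H.
have [/= h1 [h2 _]] := scan_mono s (U, C :|: facet_edges E x.2, q).
have sU : {subset s <= U} by move=> z; rewrite sL !inE => /andP[/andP[]].
have hE : E :\: (C :|: facet_edges E x.2) \subset E :\: C.
  by rewrite setDS // subsetUl.
have h3 := subset_leq_card (setDS E h2).
have := scan_progress (C :|: facet_edges E x.2) q sU.
case=> [st'E|lt]; last first.
  apply: IHa => //; rewrite -ltnS; apply: leq_trans la; rewrite ltnS -addSn.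
  by rewrite leq_add // (leq_trans h3) // subset_leq_card.
rewrite st'E in ok' *; case: (boolP (x \in C)) => xC.
  have CE : C :|: facet_edges E x.2 = C.
    apply/setUidPl/subsetP=> e; rewrite inE => /andP[eE /eqP ex].
    by case: ok => [[_ HC] _ _ _ _]; exact: (HC x).
  rewrite CE in ok' *; apply: IHb => //=.
  case: ok => Cc _ _ _ nd; have := leading_weight Cc nd xC us sL.
  by move: lb; rewrite big_cat big_cons /=; lia.
apply: IHa => //=; rewrite -ltnS; apply: leq_trans la.
rewrite ltnS ltn_add2l proper_card //.
have xE : x \in E.
  by case: ok => _ _ qU0 _ _; rewrite (subsetP U0E) // qU0 ?mem_head.
apply/properP; split=> //; exists x; rewrite !inE xE ?xC //=.
by rewrite eqxx orbT.
Qed.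

End Frontier.

(** * Repeating the search until every up-edge has been output or reversed *)

Section FrontierLoop.
Variables (V : finType) (E0 : {set edge V}).
Implicit Types (E C U O R : {set edge V}) (x y e : edge V).

Hypothesis bipartite : forall e e', e \in E0 -> e' \in E0 -> e.1 != e'.2.
Hypothesis full : forall x y, x \in E0 -> y \in E0 -> facet y.1 x.2 ->
  (y.1, x.2) \in E0.

(** The last clause is what [rankedU] requires when the next collected pairs join [O]. *)
Definition loop_ok E U O :=
  [/\ facet_closed E0 E, U \subset E, matching E0 (O :|: U), ranked O &
      forall x y, x \in O -> y \in U -> ~~ facet y.1 x.2].

Section Step.
Variables (E U O : {set edge V}) (x : edge V).
Hypotheses (ok : loop_ok E U O) (xU : x \in U).

Let EE0 : E \subset E0. Proof. by case: ok => [[]]. Qed.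

Let bipE e e' : e \in E -> e' \in E -> e.1 != e'.2.
Proof. by move=> /(subsetP EE0) eE /(subsetP EE0); exact: bipartite. Qed.

Let mU : matching E U.
Proof.
case: ok => _ UE /matchingP[_ H] _ _; apply/matchingP; split=> // y z yU zU.
by apply: H; rewrite inE ?yU ?zU orbT.
Qed.

Let ok0 : bfs_ok E U (U, set0, [:: x]).
Proof.
split=> //.
- exact: facet_closed0.
- by move=> z; rewrite inE => /eqP->.
- by move=> z y; rewrite !inE.
- apply: (@no_dicycle_descending _ _ (fun _ => 0)) => a b.
  by rewrite /darc /= !inE andbF.
Qed.

Lemma loop_bfs_total : exists U' C, bfs E (U, set0, [:: x]) U' C.
Proof. by have := bfs_total bipE mU ok0. Qed.

Lemma loop_step U' C : bfs E (U, set0, [:: x]) U' C ->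
  loop_ok (E :\: C) (U' :\: C) (O :|: (C :&: U')) /\ #|U' :\: C| < #|U|.
Proof.
move=> H; have [[Cc UU0 _ cov nd] /= UU xC] := bfs_sound bipE mU H ok0.
have {}xC : x \in C by apply: xC; right; rewrite inE.
case: ok => [[_ Ec] UE mOU rO lead].
have [CE CC] := Cc.
have sub : O :|: (C :&: U') :|: (U' :\: C) \subset O :|: U.
  rewrite -setUA setUS // subUset (subset_trans (subsetIr _ _) UU).
  exact: subset_trans (subsetDl _ _) UU.
split; last first.
  apply: proper_card; apply/properP; split.
    exact: subset_trans (subsetDl _ _) UU.
  by exists x => //; rewrite inE xC.
have inj y z : y \in U' -> z \in U' -> y.1 = z.1 \/ y.2 = z.2 -> y = z.
  move=> /(subsetP UU) yU /(subsetP UU) zU yz.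
  case/matchingP: mU => _; apply=> //.
  by case: yz; [constructor 1 | constructor 4].
(* The facet relation yields a down-edge of [C]: [full] puts it in [E0], closedness puts it in [E]
   and then in [C], and as an up-edge it would force [y = z]. *)
have step y z : y \in C :&: U' -> z \in U' -> y != z -> facet z.1 y.2 ->
    (z.1, y.2) \in C /\ (z.1, y.2) \notin U'.
  rewrite inE => /andP[yC yU'] zU' yz fzy.
  have yE := subsetP CE _ yC.
  have zE := subsetP UE _ (subsetP UU _ zU').
  have zyE0 := full (subsetP EE0 _ yE) (subsetP EE0 _ zE) fzy.
  have zyE : (z.1, y.2) \in E by exact: (Ec y).
  split; first exact: (CC y).
  apply: contra yz => zyU'; apply/eqP; apply: (inj y z) => //; left.
  have <- : (z.1, y.2) = y by apply: inj => //; right.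
  by [].
split.
- split; first exact: subset_trans (subsetDl _ _) EE0.
  move=> e e'; rewrite !inE => /andP[eC eE] e'E0 ee'.
  have e'E : e' \in E by exact: (Ec e).
  rewrite e'E andbT; apply: contra eC => e'C.
  exact: (CC e').
- exact: setSD (subset_trans UU UE).
- exact: matching_sub mOU sub.
- apply: rankedU => //.
    (* The potential of the upper end serves as rank, since two arcs of the acyclic [C] lead from
       [y.2] over [z.1] to [z.2]. *)
    case/no_dicycleP: nd => f Hf; exists (fun y => f y.2) => y z yN zN yz fzy.
    move: (zN); rewrite inE => /andP[zC zU'].
    have [zyC zyU'] := step _ _ yN zU' yz fzy.
    apply: (@ltn_trans (f z.1)); apply: Hf; rewrite /darc /= !inE.
      by rewrite -surjective_pairing zC zU'.
    by rewrite zyC zyU' orbT.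
  by move=> y z yO; rewrite inE => /andP[_ /(subsetP UU)]; exact: lead.
- move=> y z; rewrite !inE => /orP[yO|yN] /andP[zC zU'].
    by apply: lead => //; exact: (subsetP UU).
  apply: contraNN (zC) => fzy.
  have yz : y != z by apply: contraTneq yN => ->; rewrite (negPf zC).
  have [|zyC zyU'] := step _ _ _ zU' yz fzy; first by rewrite inE.
  case: (cov y z) => //; first by rewrite inE.
  rewrite !inE zU' zyU' (subsetP CE _ zyC) !andbT.
  exact: (subsetP UE _ (subsetP UU _ zU')).
Qed.

End Step.

Lemma frontier_loop_sound E U O R : frontier_loop E U O R -> loop_ok E U O ->
  matching E0 R /\ ranked R.
Proof.
elim=> [{}E {}O|{}E {}U {}O x U' C {}R xU H _ IH] ok.
  by case: ok => _ _; rewrite setU0.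
by apply: IH; case: (loop_step ok xU H).
Qed.

Lemma frontier_loop_total E U O : loop_ok E U O ->
  exists R, frontier_loop E U O R.
Proof.
have [n] := ubnP #|U|; elim: n E U O => // n IHn E U O ltn ok.
have [->|[x xU]] := set_0Vmem U; first by exists O; constructor.
have [U' [C H]] := loop_bfs_total ok xU.
have [ok' lt] := loop_step ok xU H.
have [R HR] := IHn _ _ _ (leq_trans lt ltn) ok'.
by exists R; apply: frontier_step xU H HR.
Qed.

Lemma loop_ok0 U : matching E0 U -> loop_ok E0 U set0.
Proof.
move=> mU; split=> //; rewrite ?set0U //; last by move=> x y; rewrite inE.
  by case/matchingP: mU.
exact: ranked0.
Qed.

Lemma frontier_sound R : frontier E0 R -> matching E0 R /\ ranked R.
Proof. by case=> U /andP[mU _] /frontier_loop_sound; apply; exact: loop_ok0. Qed.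

Lemma frontier_total : exists R, frontier E0 R.
Proof.
have [U mU maxU] := @arg_maxnP _ set0 (matching E0) (fun M => #|M|) (matching0 _).
have [R HR] := frontier_loop_total (loop_ok0 mU).
exists R; exists U => //; rewrite /maximum_matching mU /=.
by apply/forallP=> M; apply/implyP=> /maxU.
Qed.

End FrontierLoop.

(** * Components of an interface *)

Section Complex.
Variables (V : finType) (K : {set {set V}}).
Hypothesis K_complex : simplicial_complex K.
Implicit Types (S F B : {set {set V}}) (M N : {set edge V}) (x y : edge V)
  (s t : {set V}).

Lemma simplex_neq0 s : s \in K -> s != set0.
Proof. by case: K_complex => K0 _; apply: contraTneq => ->. Qed.

Lemma card_simplex s : s \in K -> #|s| = (dim s).+1.
Proof. by move/simplex_neq0; rewrite -card_gt0 /dim; case: #|s|. Qed.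

Lemma facetE t s : t != set0 -> facet t s -> exists2 a, a \in s & t = s :\ a.
Proof.
rewrite -card_gt0 => t0 /andP[ts /eqP]; rewrite /dim => ds.
have c1 : #|s :\: t| = 1 by rewrite cardsD (setIidPr ts); lia.
have /cards1P[a sta] : #|s :\: t| == 1 by rewrite c1.
have : a \in s :\: t by rewrite sta inE.
rewrite inE => /andP[at_ as_]; exists a => //.
by rewrite -sta setDDr setDv set0U (setIidPr ts).
Qed.

Lemma facet_setD1 s a : a \in s -> 1 < #|s| -> facet (s :\ a) s.
Proof.
move=> as_; rewrite (cardsD1 a) as_ => s1.
by rewrite /facet subsetDl /dim (cardsD1 a s) as_ /=; case: #|_| s1.
Qed.

Lemma facet_subset_simplex t s : s \in K -> t != set0 -> facet t s -> t \in K.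
Proof. by move=> sK t0 /andP[ts _]; case: K_complex => _ H; apply: H ts. Qed.

Lemma card_facets s : s \in K -> #|[set t in K | facet t s]| <= (dim s).+1.
Proof.
move=> sK; rewrite -card_simplex //.
apply: leq_trans (leq_imset_card (fun a => s :\ a) s).
apply/subset_leq_card/subsetP=> t; rewrite inE => /andP[/simplex_neq0 t0].
by case/(facetE t0) => a as_ ->; apply: imset_f.
Qed.

Lemma facet_neq t s : t \in K -> s \in K -> facet t s ->
  exists t', [/\ t' \in K, t' != t & facet t' s].
Proof.
move=> tK sK fts.
have [a as_ tE] := facetE (simplex_neq0 tK) fts.
have /set0Pn[b] := simplex_neq0 tK; rewrite {1}tE !inE => /andP[ba bs].
have s1 : 1 < #|s|.
  by rewrite (cardsD1 a) as_ (cardsD1 b) !inE ba bs.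
exists (s :\ b); split; last exact: facet_setD1.
  apply: facet_subset_simplex sK _ (facet_setD1 bs s1).
  by apply/set0Pn; exists a; rewrite !inE eq_sym ba.
by apply/eqP=> /setP/(_ a); rewrite ?tE !inE eqxx eq_sym ba as_.
Qed.

(** This is the diamond property: [s] has two points outside [r], and removing either one gives an
    intermediate face. *)
Lemma ridge_neq r t s : r \in K -> s \in K -> facet r t -> facet t s ->
  exists t', [/\ t' \in K, t' != t, facet t' s & facet r t'].
Proof.
move=> rK sK frt fts; have r0 := simplex_neq0 rK.
have t0 : t != set0.
  by apply: contraNneq r0 => t0; case/andP: frt; rewrite t0 subset0.
have [a as_ tE] := facetE t0 fts; have [b bt rE] := facetE r0 frt.
move: bt; rewrite tE !inE => /andP[ba bs].
have rE' : r = (s :\ b) :\ a.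
  by rewrite rE tE; apply/setP=> z; rewrite !inE andbCA.
have b1 : 1 < #|s :\ b|.
  rewrite (cardsD1 a) !inE eq_sym ba as_ -rE'.
  by rewrite -card_gt0 in r0; lia.
have fb : facet (s :\ b) s.
  by apply: facet_setD1 => //; move: b1; rewrite (cardsD1 b s) bs; lia.
exists (s :\ b); split=> //.
- apply: facet_subset_simplex sK _ fb; rewrite -card_gt0; lia.
- by apply/eqP=> /setP/(_ a); rewrite ?tE !inE eqxx eq_sym ba as_.
- by rewrite rE'; apply: facet_setD1; rewrite // !inE eq_sym ba.
Qed.

Section Induced.
Variables (S : {set {set V}}) (d : nat) (B : {set {set V}}).
Hypothesis (B_level : B \subset level S d).

Let F := induced S B.

Lemma induced_sub : F \subset S.
Proof.
rewrite subUset; apply/andP; split; last by apply/subsetP=> t; rewrite inE => /andP[].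
by apply: subset_trans B_level _; apply/subsetP=> t; rewrite inE => /andP[].
Qed.

Lemma induced_cases t : t \in F -> t \in B /\ dim t = d \/
  (dim t).+1 = d /\ exists2 s, s \in B & facet t s.
Proof.
have Bd s : s \in B -> dim s = d.
  by move/(subsetP B_level); rewrite inE => /andP[_ /eqP].
rewrite inE => /orP[tB|]; first by left; split; last exact: Bd.
rewrite inE => /andP[_ /exists_inP[s sB fts]]; right.
by split; [rewrite -(facet_dim fts) Bd | exists s].
Qed.

Lemma induced_facet t s : s \in B -> t \in S -> facet t s -> t \in F.
Proof.
by move=> sB tS fts; rewrite !inE tS; apply/orP; right; apply/exists_inP; exists s.
Qed.

Lemma induced_edge x : x \in edges F ->
  [/\ x.1 \in F, x.2 \in B, facet x.1 x.2, dim x.2 = d & (dim x.1).+1 = d].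
Proof.
rewrite mem_edges => /and3P[x1 x2 f]; have fd := facet_dim f.
case: (induced_cases x2) => [[x2B dx2]|[dx2 _]].
  by split=> //; rewrite -fd.
by case: (induced_cases x1) => [[_ dx1]|[dx1 _]]; exfalso; lia.
Qed.

Lemma induced_bipartite x y : x \in edges F -> y \in edges F -> x.1 != y.2.
Proof.
move=> /induced_edge[_ _ _ _ dx] /induced_edge[_ _ _ dy _].
by apply/eqP=> xy; rewrite xy dy in dx; case: (n_Sn d).
Qed.

Lemma induced_full x y : x \in edges F -> y \in edges F -> facet y.1 x.2 ->
  (y.1, x.2) \in edges F.
Proof.
rewrite !mem_edges => /and3P[_ x2 _] /and3P[y1 _ _] f.
by rewrite /= y1 x2.
Qed.

Lemma greedy_sound M M' : greedy F d M M' ->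
  matching (edges F) M -> ranked M ->
  [/\ matching (edges F) M', ranked M' &
      forall t, t \in F -> (dim t).+1 = d -> exists2 x, x \in M' & facet t x.2].
Proof.
elim=> [{}M stop|{}M t s {}M' fr sF fts _ IH] mM rM.
  split=> // t tF dt.
  have xF x : x \in M -> x \in edges F by case/matchingP: mM => /subsetP ME _; exact: ME.
  case: (boolP (t \in regular M)) => [/regularP[x xM tx]|tM].
    have [_ _ f d2 _] := induced_edge (xF _ xM).
    exists x => //; case: tx => [->//|tx].
    by rewrite tx d2 in dt; case: (n_Sn d).
  case: (induced_cases tF) => [[_ dt']|[_ [s sB fts]]]; first by exfalso; lia.
  have sF : s \in F by rewrite inE sB.
  have := stop t s; rewrite /free tF dt eqxx tM fts sF /=.
  case: (boolP [forall _ in _, _]) => [_ /(_ isT isT)//|].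
  rewrite negb_forall_in => /exists_inP[s' s'F].
  rewrite negb_imply negbK => /andP[fts' /regularP[x xM s'x]] _.
  exists x => //; case: s'x => [s'x|<- //].
  have [_ _ _ _ d1] := induced_edge (xF _ xM).
  by have := facet_dim fts'; rewrite s'x dt -{1}d1 => /n_Sn.
case/and4P: fr => tF /eqP dt tM /forall_inP fr.
have sM : s \notin regular M by have := fr s sF; rewrite fts.
have [] := @matching_ranked_add _ (edges F) M t s mM rM => //.
- by rewrite mem_edges /= tF sF.
- by apply/eqP=> ts; have := facet_dim fts; rewrite ts => /n_Sn.
- move=> x xM; apply/negP=> f; have x2F : x.2 \in F.
    by case/matchingP: mM => /subsetP/(_ x xM)+ _; rewrite mem_edges => /and3P[].
  by have := fr _ x2F; rewrite f regular2.
Qed.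

Lemma greedy_total M : exists M', greedy F d M M'.
Proof.
have [n] := ubnP #|~: M|; elim: n M => // n IHn M ltn.
case: (pickP (fun e : edge V =>
    [&& free F d M e.1, e.2 \in F & facet e.1 e.2])) => [[t s]|stop].
  case/and3P=> /= fr sF fts; have [|M' HM'] := IHn ((t, s) |: M); last first.
    by exists M'; apply: greedy_step fr sF fts HM'.
  rewrite -ltnS; apply: leq_trans ltn; rewrite ltnS; apply: proper_card.
  apply/properP; split; first by rewrite setCS subsetUr.
  exists (t, s); rewrite !inE ?eqxx //.
  by case/and4P: fr => _ _ tM _; apply: contra tM => /regular1.
exists M; constructor => t s fr sF; apply/negP=> fts.
by have := stop (t, s); rewrite /= fr sF fts.
Qed.

Lemma intermediate_apx_sound N : intermediate_apx F d N ->
  [/\ matching (edges F) N, ranked N &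
      forall t, t \in F -> (dim t).+1 = d -> exists2 x, x \in N & facet t x.2].
Proof.
case=> R fR gN.
by case: (frontier_sound induced_bipartite induced_full fR); apply: greedy_sound.
Qed.

Lemma intermediate_apx_total : exists N, intermediate_apx F d N.
Proof.
have [R fR] := frontier_total induced_bipartite induced_full.
by have [N gN] := greedy_total R; exists N; exists R.
Qed.

End Induced.

End Complex.

(** * Processing an interface *)

Section Process.
Variables (V : finType) (K : {set {set V}}).
Hypothesis K_complex : simplicial_complex K.
Implicit Types (S F B : {set {set V}}) (M N : {set edge V}) (x y : edge V)
  (s t : {set V}).

Lemma card_bigcup_leq (I T : finType) (A : {set I}) (f : I -> {set T}) b :
  (forall i, i \in A -> #|f i| <= b) -> #|\bigcup_(i in A) f i| <= b * #|A|.
Proof.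
move=> fb; apply: (@leq_trans (\sum_(i in A) b)); last first.
  by rewrite sum_nat_const mulnC.
elim/big_ind2: _ => [|n1 X1 n2 X2 h1 h2|i iA]; rewrite ?cards0 //; last exact: fb.
by rewrite cardsU; apply: leq_trans (leq_subr _ _) (leq_add h1 h2).
Qed.

Lemma mem_level S d s : (s \in level S d) = (s \in S) && (dim s == d).
Proof. by rewrite inE. Qed.

Lemma facet_degree_gt0P S s :
  reflect (exists2 t, t \in S & facet t s) (0 < facet_degree S s).
Proof.
rewrite card_gt0; apply: (iffP (set0Pn _)) => [[t]|[t tS fts]].
  by rewrite inE => /andP[tS fts]; exists t.
by exists t; rewrite inE tS.
Qed.

(** The two alternatives become the two summands of the bound in [pairs_covered]. *)
Definition covered M t := exists2 x, x \in M & t = x.2 \/ facet t x.2.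

Lemma covered_sub M N t : M \subset N -> covered M t -> covered N t.
Proof. by move=> /subsetP MN [x /MN xN]; exists x. Qed.

(** Deleting the critical [(d-1)]-simplices together with the matched ones is what preserves
    [valid_facet], and this field allows later pairs to be ranked above earlier ones. *)
Record valid S M : Prop := Valid {
  valid_sub : S \subset K;
  valid_matching : matching (edges K) M;
  valid_ranked : ranked M;
  valid_deleted : forall s, s \in S -> s \notin regular M;
  valid_facet : forall x t, x \in M -> t \in S -> ~~ facet t x.2 }.

Record ready d S M : Prop := Ready {
  ready_valid : valid S M;
  ready_high : forall s, s \in K -> d <= dim s -> s \in S;
  ready_low : forall t, t \in K -> (dim t).+1 = d ->
    t \in S \/ exists2 x, x \in M & x.2 = t;
  ready_dim : forall x, x \in M -> dim x.2 < d;
  ready_covered : forall t s, t \in K -> s \in K -> facet t s -> dim s < d ->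
    covered M t }.

(* ready: the interface d is about to be processed; midway: some of its
   components have been processed. *)
Record midway d S M : Prop := Midway {
  mid_valid : valid S M;
  mid_high : forall s, s \in K -> d < dim s -> s \in S;
  mid_level : forall s, s \in K -> dim s = d ->
    s \in S \/ exists2 x, x \in M & x.2 = s;
  mid_dim : forall x, x \in M -> dim x.2 <= d;
  mid_covered : forall t s, t \in K -> s \in K -> facet t s -> dim s < d ->
    covered M t;
  mid_low : forall t, t \in K -> (dim t).+1 = d -> t \in S \/ covered M t }.

Lemma ready_midway d S M : ready d S M -> midway d S M.
Proof.
case=> vSM high low dimM cov; split=> //.
- by move=> s sK /ltnW; apply: high.
- by move=> s sK sd; left; apply: high; rewrite ?sd.
- by move=> x /dimM /ltnW.
- by move=> t tK /(low t tK)[|[x xM xt]]; [left | right; exists x; auto].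
Qed.

(** A deleted [d]-simplex is the upper end of a pair, and none of its facets remains. *)
Lemma midway_facet d S M t s : midway d S M -> t \in S -> s \in K ->
  facet t s -> dim s = d -> s \in S.
Proof.
move=> mid tS sK fts /(mid_level mid sK)[//|[x xM xs]].
by have := valid_facet (mid_valid mid) xM tS; rewrite xs fts.
Qed.

Lemma midway_ready d S M : midway d S M ->
  (forall s, s \in level S d -> facet_degree S s = 0) -> ready d.+1 S M.
Proof.
move=> mid deg0.
have isolated t s : t \in S -> s \in K -> facet t s -> dim s <> d.
  move=> tS sK fts sd; have sS := midway_facet mid tS sK fts sd.
  have : 0 < facet_degree S s by apply/facet_degree_gt0P; exists t.
  by rewrite deg0 // mem_level sS sd eqxx.
split; first exact: mid_valid mid.
- exact: mid_high mid.
- by move=> t tK [td]; exact: (mid_level mid).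
- exact: mid_dim mid.
- move=> t s tK sK fts; rewrite ltnS leq_eqVlt => /predU1P[sd|]; last first.
    exact: (mid_covered mid tK sK fts).
  case: (mid_low mid tK); rewrite -?(facet_dim fts) // => tS.
  by case: (isolated _ _ tS sK fts).
Qed.

Section Step.
Variables (d : nat) (S : {set {set V}}) (M N : {set edge V}) (F : {set {set V}}).
Hypotheses (mid : midway d S M) (compF : min_facet_component S d F)
  (apxN : intermediate_apx F d N).

Let component : exists2 B, F = induced S B &
  [/\ B \subset min_facet_simplices S d, B \subset level S d & B != set0].
Proof.
case: compF => B /maxsetp /andP[Bmin /andP[F0 _]] FE; exists B => //; split=> //.
  by apply: subset_trans Bmin _; apply/subsetP=> s; rewrite inE => /andP[].
apply: contraNneq F0 => ->; apply/eqP/setP=> t; rewrite !inE /= andbC.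
by apply/negP=> /andP[/exists_inP[s]]; rewrite inE.
Qed.

Let SK : S \subset K := valid_sub (mid_valid mid).

Lemma midway_step : midway d (S :\: deleted F d N) (M :|: N).
Proof.
have [B FE [_ Blev _]] := component.
move: apxN; rewrite {1}FE => /(intermediate_apx_sound Blev)[mN rN maxN].
have FS : F \subset S by rewrite FE; exact: induced_sub Blev.
have edgeN x : x \in N -> [/\ x.1 \in F, x.2 \in B, facet x.1 x.2,
    dim x.2 = d & (dim x.1).+1 = d].
  by move=> xN; rewrite FE; apply: (induced_edge Blev);
    case/matchingP: mN => /subsetP NE _; exact: NE.
have BS s : s \in B -> s \in S /\ dim s = d.
  by move/(subsetP Blev); rewrite mem_level => /andP[-> /eqP].
have regN s : s \in regular N -> s \in F.
  case/regularP=> x /edgeN[x1 x2 _ _ _] [] -> //.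
  by rewrite FE inE x2.
have [v high lev dimM cov low] := mid.
have delF t : t \in F -> (dim t).+1 = d -> t \in deleted F d N.
  by move=> tF td; rewrite !inE tF td eqxx /=; case: (_ \in _).
have delE t : t \in deleted F d N -> t \in F /\
    ((dim t).+1 = d \/ exists2 x, x \in N & x.2 = t).
  rewrite inE => /orP[tN|]; last by rewrite inE => /and3P[-> /eqP]; auto.
  split; first exact: regN.
  by case/regularP: tN => x xN [] ->; [left; case/edgeN: xN | right; exists x].
split; first split.
- by apply: subset_trans SK; exact: subsetDl.
- apply: (matchingU (valid_matching v)).
    apply: matching_mono mN _; rewrite -FE; apply/subsetP=> x.
    rewrite !mem_edges => /and3P[/(subsetP FS) x1 /(subsetP FS) x2 ->].
    by rewrite !(subsetP SK).
  move=> s sM /regN /(subsetP FS) /(valid_deleted v).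
  by rewrite sM.
- apply: (rankedU (valid_ranked v) rN) => x y xM /edgeN[/(subsetP FS) y1 _ _ _ _].
  exact: (valid_facet v xM y1).
- move=> s; rewrite in_setD => /andP[sdel sS].
  apply/negP=> /regularP[x]; rewrite inE => /orP[xM|xN] sx.
    by have /negP[] := valid_deleted v sS; apply/regularP; exists x.
  by case/negP: sdel; rewrite inE; apply/orP; left; apply/regularP; exists x.
- move=> x t; rewrite inE => /orP[xM|xN]; rewrite in_setD => /andP[tdel tS].
    exact: (valid_facet v xM tS).
  apply: contra tdel => f; have [_ x2 _ d2 _] := edgeN _ xN.
  apply: delF; last by rewrite -(facet_dim f).
  by rewrite FE; exact: induced_facet f.
- move=> s sK sd; rewrite in_setD high // andbT; apply/negP=> /delE[_].
  case=> [dt|[x /edgeN[_ _ _ d2 _] xs]]; first lia.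
  by rewrite -xs d2 ltnn in sd.
- move=> s sK sd; case: (lev s sK sd) => [sS|[x xM xs]]; last first.
    by right; exists x; rewrite // inE xM.
  case: (boolP (s \in deleted F d N)) => [/delE[_ []]|nd].
  + by rewrite sd => /esym/n_Sn.
  + by case=> x xN xs; right; exists x; rewrite // inE xN orbT.
  + by left; rewrite in_setD nd.
- by move=> x; rewrite inE => /orP[/dimM|/edgeN[_ _ _ ->]].
- move=> t s tK sK fts ds; apply: covered_sub (cov t s tK sK fts ds).
  exact: subsetUl.
- move=> t tK td; case: (low t tK td) => [tS|tM]; last first.
    by right; apply: covered_sub tM; exact: subsetUl.
  case: (boolP (t \in deleted F d N)) => [/delE[tF _]|nd].
    rewrite FE in tF; have [x xN f] := maxN t tF td.
    by right; exists x; rewrite ?inE ?xN ?orbT; auto.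
  by left; rewrite in_setD nd.
Qed.

Lemma step_smaller : #|S :\: deleted F d N| < #|S|.
Proof.
have [B FE [/subsetP Bmin Blev /set0Pn[s sB]]] := component.
apply: proper_card; apply/properP; split; first exact: subsetDl.
have := Bmin s sB; rewrite inE => /and3P[sl /facet_degree_gt0P[t tS fts] _].
exists t => //; rewrite in_setD tS andbT negbK !inE.
have -> : t \in F by rewrite FE; exact: induced_facet sB tS fts.
move: sl; rewrite mem_level -(facet_dim fts) => /andP[_ ->].
by case: (_ \in _).
Qed.

(** Each deleted [(d-1)]-simplex is a facet of the upper end of a new pair. That upper end has
    minimum facet degree, hence at most [b] remaining facets, so each new pair pays for at most [b]
    deletions. *)
Lemma step_count b s : s \in level S d -> 0 < facet_degree S s <= b ->
  #|level S d.-1| + b * #|M| <=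
  #|level (S :\: deleted F d N) d.-1| + b * #|M :|: N|.
Proof.
move=> sl sb.
have [B FE [Bmin Blev _]] := component.
move: apxN; rewrite {1}FE => /(intermediate_apx_sound Blev)[mN rN maxN].
have edgeN x : x \in N -> [/\ x.1 \in F, x.2 \in B, facet x.1 x.2,
    dim x.2 = d & (dim x.1).+1 = d].
  by move=> xN; rewrite FE; apply: (induced_edge Blev);
    case/matchingP: mN => /subsetP NE _; exact: NE.
have FS : F \subset S by rewrite FE; exact: induced_sub Blev.
rewrite cardsU (_ : M :&: N = set0) ?cards0 ?subn0; last first.
  apply/setP=> x; rewrite !inE; apply/negP=> /andP[xM /edgeN[x1 _ _ _ _]].
  by have := valid_deleted (mid_valid mid) (subsetP FS _ x1); rewrite regular1.
pose G := \bigcup_(x in N) [set t in S | facet t x.2].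
have cG : #|G| <= b * #|N|.
  apply: card_bigcup_leq => x /edgeN[_ /(subsetP Bmin) x2 _ _ _].
  move: x2 sb; rewrite inE => /and3P[_ _ /forall_inP/(_ s sl) h] /andP[s0 sb].
  by move: h; rewrite s0 /= => /leq_trans; exact.
suff h : #|level S d.-1| <= #|level (S :\: deleted F d N) d.-1| + #|G|.
  rewrite mulnDr; apply: leq_trans (leq_add h (leqnn _)) _.
  by rewrite -addnA leq_add2l addnC leq_add2l.
apply: leq_trans (_ : #|level (S :\: deleted F d N) d.-1 :|: G| <= _).
  apply/subset_leq_card/subsetP=> t; rewrite in_setU !mem_level in_setD.
  case/andP=> tS /eqP td; rewrite tS td eqxx !andbT.
  case: (boolP (t \in deleted F d N)) => //= tdel.
  have [tF td'] : t \in F /\ (dim t).+1 = d.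
    move: tdel; rewrite inE => /orP[/regularP[x /edgeN[x1 _ _ d2 d1] tx]|].
      case: tx => tx; first by rewrite tx.
      by move: td; rewrite tx d2 -d1 => /esym/n_Sn.
    by rewrite inE => /and3P[-> /eqP].
  rewrite FE in tF; have [x xN f] := maxN t tF td'.
  by apply/bigcupP; exists x; rewrite // inE tS.
by rewrite cardsU leq_subr.
Qed.

End Step.

(** The number [b] bounds the minimum facet degree throughout the processing. It is instantiated
    with [d.+1] in general and with [d] for a connected interface. *)
Lemma process_sound d b S M S' M' : process d S M S' M' -> midway d S M ->
  (forall S1 M1, midway d S1 M1 -> S1 \subset S ->
     forall s, s \in level S1 d -> 0 < facet_degree S1 s ->
     exists2 s', s' \in level S1 d & 0 < facet_degree S1 s' <= b) ->
  [/\ ready d.+1 S' M', M \subset M' &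
      #|level S d.-1| + b * #|M| <= #|level S' d.-1| + b * #|M'|].
Proof.
elim=> {S M S' M'} [S M deg0|S M s F N S' M' sl s0 comp apx _ IH] mid Hb.
  by split=> //; exact: midway_ready.
case: (IH (midway_step mid comp apx)) => [S1 M1 mid1 sub1|r sub le].
  by apply: Hb mid1 _; apply: subset_trans sub1 _; exact: subsetDl.
have [s' s'l s'b] := Hb S M mid (subxx _) s sl s0.
split=> //; first by apply: subset_trans sub; exact: subsetUl.
exact: leq_trans (step_count mid comp apx s'l s'b) le.
Qed.

(** One simplex of minimum degree with its remaining facets forms a connected star, which extends to
    a maximal set. *)
Lemma min_facet_component_exists d S s :
  s \in level S d -> 0 < facet_degree S s ->
  exists F, min_facet_component S d F.
Proof.
move=> sl s0.
have [s1 /andP[s1l s10] min1] := @arg_minnP _ s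
  [pred s | (s \in level S d) && (0 < facet_degree S s)] (facet_degree S)
  (introT andP (conj sl s0)).
have [|B maxB _] := @maxset_exists _ (fun B : {set {set V}} =>
      (B \subset min_facet_simplices S d) && connected (induced S B)) [set s1].
  apply/andP; split.
    rewrite sub1set inE s1l s10; apply/forall_inP=> s' s'l.
    by apply/implyP=> s'0; apply: min1; rewrite /= s'l.
  have s1I : s1 \in induced S [set s1] by rewrite !inE eqxx.
  apply/andP; split; first by apply/set0Pn; exists s1.
  have to1 t : t \in induced S [set s1] ->
      connect (adjacent (induced S [set s1])) t s1 /\
      connect (adjacent (induced S [set s1])) s1 t.
    move=> tI; move: (tI); rewrite !inE => /orP[/eqP->//|].
    case/andP=> tS /exists_inP[s2 /set1P-> f].
    have e : (t, s1) \in edges (induced S [set s1]).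
      by rewrite mem_edges /= tI s1I.
    by split; apply: connect1; rewrite /adjacent /= e ?orbT.
  apply/forall_inP=> t /to1[ts _]; apply/forall_inP=> s' /to1[_ ss'].
  exact: connect_trans ts ss'.
by exists (induced S B); exists B.
Qed.

Lemma process_total d S M : midway d S M -> exists S' M', process d S M S' M'.
Proof.
have [n] := ubnP #|S|; elim: n S M => // n IHn S M ltn mid.
case: (pickP (fun s => (s \in level S d) && (0 < facet_degree S s))) => [s|no].
  case/andP=> sl s0.
  have [F comp] := min_facet_component_exists sl s0.
  have [N apx] : exists N, intermediate_apx F d N.
    case: (comp) => B /maxsetp /andP[Bmin _] ->.
    apply: intermediate_apx_total; apply: subset_trans Bmin _.
    by apply/subsetP=> t; rewrite inE => /andP[].
  have lt := leq_trans (step_smaller N comp) ltn.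
  have [S' [M' P]] := IHn _ _ lt (midway_step mid comp apx).
  by exists S', M'; exact: process_step sl s0 comp apx P.
exists S, M; constructor => s sl; have := no s; rewrite sl /=.
by case: (facet_degree S s).
Qed.

End Process.

(** * Depth-first search *)

Section DepthFirst.
Variables (V : finType) (K : {set {set V}}).
Hypothesis K_complex : simplicial_complex K.
Implicit Types (A : {set {set V}}) (p : seq {set V}) (M N : {set edge V})
  (x : edge V) (e s t u v w : {set V}).

Lemma connect_stable (T : finType) (r : rel T) (P : T -> Prop) a b :
  (forall c d, r c d -> P c -> P d) -> connect r a b -> P a -> P b.
Proof.
move=> rP /connectP[p]; elim: p a => [|c p IHp] a /=; first by move=> _ ->.
by case/andP=> ac cp bE Pa; apply: IHp cp bE _; exact: rP ac Pa.
Qed.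

Lemma dim0_facets e v w u : e \in K -> v \in K -> w \in K -> u \in K ->
  dim e = 1 -> facet v e -> facet w e -> v != w -> facet u e -> u = v \/ u = w.
Proof.
move=> eK vK wK uK e1 fv fw vw fu.
have /eqP E : [set v; w] == [set t in K | facet t e].
  rewrite eqEcard cards2 vw; apply/andP; split.
    by apply/subsetP=> t; rewrite !inE => /orP[]/eqP->; rewrite ?vK ?wK.
  by apply: leq_trans (card_facets K_complex eK) _; rewrite e1.
have : u \in [set v; w] by rewrite E inE uK.
by rewrite !inE => /orP[]/eqP; auto.
Qed.

Lemma interface_edge d c e : (c, e) \in edges (interface K d) ->
  [/\ c \in K, e \in K, facet c e, (dim c).+1 = d & dim e = d].
Proof.
rewrite mem_edges /= => /and3P[+ + f].
rewrite !inE => /andP[-> hc] /andP[-> he]; have := facet_dim f.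
by case/orP: hc => /eqP hc; case/orP: he => /eqP he; split=> //; lia.
Qed.

Definition linked v w :=
  exists2 e, e \in level K 1 & facet v e && facet w e.

Definition linked_closed A := forall v w, v \in A -> w \in level K 0 ->
  linked v w -> w \in A.

(** Connectedness of the graph is phrased through closed vertex sets because the visited vertices
    form such a set whenever the branch is empty. *)
Definition link_connected := forall A v, A \subset level K 0 -> v \in A ->
  linked_closed A -> level K 0 \subset A.

(* In dfs_roots, an unmatched visited vertex is a root that has a matched incident
   edge, or is isolated, or has just been started. *)
Record dfs_ok A p N : Prop := DfsOk {
  dfs_level : A \subset level K 0;
  dfs_branch : {subset p <= A};
  dfs_matching : matching (edges K) N;
  dfs_ranked : ranked N;
  dfs_dim : forall x, x \in N -> dim x.2 = 1;
  dfs_facets : forall x w, x \in N -> w \in K -> facet w x.2 -> w \in A;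
  dfs_closed : forall v w, v \in A -> v \notin p -> w \in level K 0 ->
    linked v w -> w \in A;
  dfs_roots : forall v, v \in A -> v \notin regular N ->
    [\/ exists2 x, x \in N & facet v x.2,
        v \notin p /\ (forall e, e \in level K 1 -> ~~ facet v e) |
        p = [:: v] /\ forall w, w != v -> linked v w -> w \notin A];
  dfs_tree : link_connected ->
    exists r, forall v, v \in A -> v = r \/ v \in regular N }.

Lemma linked_sym v w : linked v w -> linked w v.
Proof. by case=> e eK; rewrite andbC; exists e. Qed.

Lemma dfs_ok_init : dfs_ok set0 [::] set0.
Proof.
split=> //.
- exact: sub0set.
- exact: matching0.
- exact: ranked0.
- by move=> x; rewrite inE.
- by move=> x w; rewrite inE.
- by move=> v w; rewrite inE.
- by move=> v; rewrite inE.
- by exists set0 => v; rewrite inE.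
Qed.

Lemma dfs_ok_start A r N : r \in level K 0 -> r \notin A ->
  dfs_ok A [::] N -> dfs_ok (r |: A) [:: r] N.
Proof.
move=> rK rA [lev _ mN rN dN fN cl rt tree]; split=> //.
- by rewrite subUset sub1set rK.
- by move=> v; rewrite !inE => /eqP->; rewrite eqxx.
- by move=> x w xN wK f; rewrite inE (fN x w) ?orbT.
- move=> v w; rewrite !inE => /predU1P[->|vA]; first by rewrite eqxx.
  by move=> _ wK vw; rewrite (cl v w) ?orbT // inE.
- move=> v; rewrite in_setU1 => /predU1P[->|vA] vN.
    (* With an empty branch [A] is closed under links, so a visited neighbour of [r] would make [r]
       visited. *)
    constructor 3; split=> // w wr rw; rewrite !inE (negPf wr) /=.
    by apply: contra rA => wA; apply: (cl w) => //; exact: linked_sym.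
  case: (rt v vA vN) => [h|[_ h]|[//]]; first by constructor 1.
  constructor 2; split=> //; rewrite inE; apply: contraNneq rA => <- //.
(* In a connected graph a restart is impossible: a nonempty closed [A] already contains every
   vertex. *)
- move=> conn; have [A0|[v vA]] := set_0Vmem A.
    by exists r => v; rewrite A0 !inE orbF => /eqP; left.
  have /subsetP/(_ r rK) := conn A v lev vA (fun u w uA => cl u w uA isT).
  by rewrite (negPf rA).
Qed.

(** All vertices of matched edges are visited ([dfs_facets]). Since [w] is not, [e] is unmatched and
    no earlier pair leads to [w]. *)
Lemma dfs_ok_visit A v p w e N :
  w \in level K 0 -> e \in level K 1 -> facet v e -> facet w e -> w \notin A ->
  dfs_ok A (v :: p) N -> dfs_ok (w |: A) [:: w, v & p] ((w, e) |: N).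
Proof.
move=> wl el fve fwe wA [lev br mN rN dN fN cl rt tree].
have [wK w0] : w \in K /\ dim w = 0 by move: wl; rewrite mem_level => /andP[? /eqP].
have [eK e1] : e \in K /\ dim e = 1 by move: el; rewrite mem_level => /andP[? /eqP].
have vA : v \in A by rewrite br ?mem_head.
have vK : v \in K by move/(subsetP lev): vA; rewrite mem_level => /andP[].
have vw : v != w by apply: contraNneq wA => <-.
have NE x : x \in N -> facet x.1 x.2.
  by case/matchingP: mN => /subsetP NE _ /NE; rewrite mem_edges => /and3P[].
have wN : w \notin regular N.
  apply: contra wA => /regularP[x xN [] wx].
    by apply: (fN x) => //; rewrite wx NE.
  by have := dN x xN; rewrite -wx w0.
have eN : e \notin regular N.
  apply: contra wA => /regularP[x xN [] ex].
    by have := facet_dim (NE x xN); rewrite -ex e1 (dN x xN).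
  by apply: (fN x) => //; rewrite -ex.
have [mN' rN'] : matching (edges K) ((w, e) |: N) /\ ranked ((w, e) |: N).
  apply: matching_ranked_add => //.
  - by rewrite mem_edges /= wK eK.
  - by apply/eqP=> we; rewrite we e1 in w0.
  - by move=> x xN; apply: contra wA; exact: fN.
have NN : {subset regular N <= regular ((w, e) |: N)}.
  by move=> u /regularP[x xN ux]; apply/regularP; exists x; rewrite // inE xN orbT.
split=> //.
- by rewrite subUset sub1set wl.
- by move=> u; rewrite in_cons in_setU1 => /predU1P[->|/br->]; rewrite ?eqxx ?orbT.
- by move=> x; rewrite in_setU1 => /predU1P[->|/dN].
- move=> x u; rewrite !in_setU1 => /predU1P[->|xN] uK /= f.
    by case: (dim0_facets eK vK wK uK e1 fve fwe vw f) => ->; rewrite ?eqxx ?vA ?orbT.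
  by rewrite (fN x u) ?orbT.
- move=> u t; rewrite in_setU1 in_cons => /predU1P[->|uA]; first by rewrite eqxx.
  by rewrite negb_or => /andP[_ up] tl ut; rewrite in_setU1 (cl u t) ?orbT.
- move=> u; rewrite in_setU1 => /predU1P[->|uA] uN.
    by case/negP: uN; rewrite (@regular1 _ _ (w, e)) // setU11.
  have uN' : u \notin regular N by apply: contra uN; exact: NN.
  case: (rt u uA uN') => [[x xN f]|[up h]|[[uv _] _]].
  + by constructor 1; exists x; rewrite // inE xN orbT.
  + constructor 2; split=> //; rewrite in_cons negb_or up andbT.
    by apply: contraNneq wA => <-.
  + by constructor 1; exists (w, e); rewrite /= -?uv // setU11.
- case/tree=> r hr; exists r => u; rewrite in_setU1 => /predU1P[->|/hr[]]; auto.
  by right; rewrite (@regular1 _ _ (w, e)) // setU11.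
Qed.

Lemma dfs_ok_backtrack A v p N :
  (forall w e, w \in level K 0 -> e \in level K 1 ->
       facet v e -> facet w e -> w \in A) ->
  dfs_ok A (v :: p) N -> dfs_ok A p N.
Proof.
move=> nb [lev br mN rN dN fN cl rt tree]; split=> //.
- by move=> u up; rewrite br // inE up orbT.
- move=> u w uA up wl uw; have [uv|uv] := eqVneq u v.
    by case: uw => e el /andP[]; rewrite uv; exact: nb wl el.
  by apply: (cl u) => //; rewrite in_cons negb_or uv.
- move=> u uA uN; case: (rt u uA uN) => [h|[up h]|[[uv p0] h]].
  + by constructor 1.
  + by constructor 2; split=> //; apply: contra up; rewrite in_cons => ->; rewrite orbT.
  (* A root abandoned right after its start has no visited neighbour, while backtracking requires
     all its neighbours to be visited; hence it is isolated. *)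
  constructor 2; rewrite p0; split=> // e el; apply/negP=> f.
  have uK : u \in K by move/(subsetP lev): uA; rewrite mem_level => /andP[].
  have [eK e1] : e \in K /\ dim e = 1.
    by move: el; rewrite mem_level => /andP[? /eqP].
  have [w [wK wu fw]] := facet_neq K_complex uK eK f.
  have wl : w \in level K 0.
    by rewrite mem_level wK; have := facet_dim fw; rewrite e1 => -[<-].
  have /negP[] : w \notin A by apply: h => //; exists e; rewrite // f.
  by apply: (nb w e) => //; rewrite uv.
Qed.

Lemma dfs_sound A p N N' : Defs.dfs K A p N N' -> dfs_ok A p N ->
  exists A', level K 0 \subset A' /\ dfs_ok A' [::] N'.
Proof.
elim=> {A p N N'} [A N lev|A r N N' rl rA _ IH|
  A v p w e N N' wl el fv fw wA _ IH|A v p N N' nb _ IH] ok.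
- by exists A.
- by apply: IH; exact: dfs_ok_start.
- by apply: IH; exact: dfs_ok_visit ok.
- by apply: IH; exact: dfs_ok_backtrack ok.
Qed.

Lemma dfs_total A p N : exists N', Defs.dfs K A p N N'.
Proof.
(* The complement of [A] counts twice because visiting a vertex also lengthens the branch by one. *)
have [n] := ubnP ((#|~: A|).*2 + size p); elim: n A p N => // n IHn A p N ltn.
have smaller w : w \notin A -> #|~: A| = #|~: (w |: A)|.+1.
  move=> wA; rewrite (cardsD1 w (~: A)) inE wA add1n setCU.
  by rewrite setIC -setDE.
case: p ltn => [|v p] ltn.
  case: (boolP (level K 0 \subset A)) => [lev|/subsetPn[r rl rA]].
    by exists N; constructor.
  have [|N' HN'] := IHn (r |: A) [:: r] N; last first.
    by exists N'; apply: dfs_start HN'.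
  by move: ltn; rewrite (smaller r rA) doubleS /= addn0 addn1 ltnS.
case: (pickP (fun x : edge V => [&& x.1 \in level K 0, x.2 \in level K 1,
    facet v x.2, facet x.1 x.2 & x.1 \notin A])) => [[w e] /and5P[/= wl el fv fw wA]|no].
  have [|N' HN'] := IHn (w |: A) [:: w, v & p] ((w, e) |: N); last first.
    by exists N'; apply: dfs_visit HN'.
  by move: ltn; rewrite (smaller w wA) doubleS /= !addSn !addnS ltnS.
have [|N' HN'] := IHn A p N; first by move: ltn; rewrite /= addnS ltnS.
exists N'; apply: dfs_backtrack HN' => w e wl el fv fw; apply/negPn/negP=> wA.
by have := no (w, e); rewrite /= wl el fv fw wA.
Qed.

Lemma connected_linked : connected (interface K 1) -> link_connected.
Proof.
case/andP=> _ /forall_inP conn A v AK vA cl; apply/subsetP=> w wl.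
have inI u : u \in level K 0 -> u \in interface K 1.
  by rewrite mem_level inE => /andP[-> /eqP->].
have vw := forall_inP (conn v (inI v (subsetP AK _ vA))) w (inI w wl).
(* This invariant passes along a Hasse path, which alternates between vertices and edges: all
   vertices of [z] lie in [A]. *)
pose P z := forall u, u \in level K 0 -> u = z \/ facet u z -> u \in A.
have lv0 u : u \in level K 0 -> dim u = 0 by rewrite mem_level => /andP[_ /eqP].
have edgeI c e : (c, e) \in edges (interface K 1) ->
    [/\ c \in level K 0, e \in level K 1 & facet c e].
  case/interface_edge=> cK eK f [c0] e1.
  by rewrite !mem_level cK eK c0 e1.
suff : P w by apply=> //; left.
apply: connect_stable vw _ => [c z /orP[] /edgeI[cl0 zl0 f] Pc u ul|u ul].
- case=> [uz|fu]; first by move: zl0; rewrite mem_level -uz lv0 // andbF.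
  by apply: (cl c) => //; [apply: Pc; auto | exists z; rewrite // f].
- case=> [->|fu]; first by apply: Pc; auto.
  by have := facet_dim fu; rewrite (lv0 z).
- by case=> [->//|/facet_dim]; rewrite (lv0 v) // (subsetP AK).
Qed.

Lemma ready1 : ready K 1 K set0.
Proof.
split.
- split=> //; first exact: matching0.
  + exact: ranked0.
  + by move=> s; rewrite regular0 inE.
  + by move=> x t; rewrite inE.
- by [].
- by left.
- by move=> x; rewrite inE.
- by move=> t s _ _ /facet_dim->.
Qed.

(** An upper end has dimension at least 1, so nothing can have been matched or deleted yet; the
    search therefore starts from all of [K]. *)
Lemma ready1_initial S M : ready K 1 S M -> S = K /\ M = set0.
Proof.
case=> v high low dimM cov.
have M0 : M = set0.
  apply/setP=> x; rewrite inE; apply/negP=> xM; have := dimM x xM.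
  case/matchingP: (valid_matching v) => /subsetP/(_ x xM)+ _.
  by rewrite mem_edges => /and3P[_ _ /facet_dim->].
split=> //; apply/eqP; rewrite eqEsubset (valid_sub v) /=.
apply/subsetP=> s sK; case ds: (dim s) => [|n]; last by rewrite high ?ds.
by case: (low s sK); rewrite ?ds // => -[x]; rewrite M0 inE.
Qed.

(** Coverage of the vertices of edges comes from [dfs_roots]: a matched vertex is a facet of its
    partner, and an unmatched one that is not isolated has a matched incident edge. *)
Lemma dfs_ready N : Defs.dfs K set0 [::] set0 N ->
  ready K 2 (K :\: deleted (interface K 1) 1 N) N.
Proof.
move=> H; have [A [lev ok]] := dfs_sound H dfs_ok_init.
have [_ _ mN rN dN fN cl rt _] := ok.
have d1 x : x \in N -> dim x.1 = 0.
  move=> xN; case/matchingP: mN => /subsetP/(_ x xN)+ _.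
  by rewrite mem_edges => /and3P[_ _ /facet_dim]; rewrite dN // => -[<-].
have del0 t : t \in K -> dim t = 0 -> t \in deleted (interface K 1) 1 N.
  by move=> tK t0; rewrite !inE tK t0 /=; case: (_ \in _).
have delE t : t \in deleted (interface K 1) 1 N ->
    dim t = 0 \/ exists2 x, x \in N & x.2 = t.
  rewrite inE => /orP[/regularP[x xN [] ->]|]; [by left; exact: d1| |].
    by right; exists x.
  by rewrite inE => /and3P[_ /eqP[->]]; left.
split; first split=> //.
- exact: subsetDl.
- by move=> s; rewrite in_setD => /andP[+ _]; apply: contra; rewrite inE => ->.
- move=> x t xN; rewrite in_setD => /andP[tdel tK]; apply: contra tdel => f.
  by apply: del0 => //; have := facet_dim f; rewrite dN // => -[<-].
- move=> s sK s2; rewrite in_setD sK andbT; apply/negP=> /delE[s0|[x xN xs]].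
    by rewrite s0 in s2.
  by rewrite -xs dN in s2.
- move=> t tK [t1]; case: (boolP (t \in deleted (interface K 1) 1 N)).
    by case/delE=> [|[x xN xt]]; [rewrite t1 | right; exists x].
  by left; rewrite in_setD tK andbT.
- by move=> x /dN->.
- move=> t s tK sK f s2.
  have [s1 t0] : dim s = 1 /\ dim t = 0 by have := facet_dim f; lia.
  have tA : t \in A by rewrite (subsetP lev) // mem_level tK t0.
  case: (boolP (t \in regular N)) => [/regularP[x xN [] tx]|tN].
  + exists x => //; right; rewrite tx; case/matchingP: mN => /subsetP/(_ x xN)+ _.
    by rewrite mem_edges => /and3P[].
  + by exists x => //; left.
  case: (rt t tA tN) => [[x xN fx]|[_ /(_ s)]|[//]]; first by exists x; auto.
  by rewrite mem_level sK s1 f => /(_ isT).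
Qed.

(** Every vertex other than the single root is the lower end of a pair. *)
Lemma dfs_spanning N : connected (interface K 1) ->
  Defs.dfs K set0 [::] set0 N -> #|level K 0| <= #|N|.+1.
Proof.
move=> conn H; have [A [lev ok]] := dfs_sound H dfs_ok_init.
have [r hr] := dfs_tree ok (connected_linked conn).
rewrite -add1n; apply: leq_trans (leq_add (leqnn 1) (leq_imset_card fst N)).
rewrite -(cards1 r); apply: leq_trans (leq_card_setU _ _).
apply/subset_leq_card/subsetP=> v vl.
rewrite inE; case: (hr v (subsetP lev _ vl)) => [->|]; first by rewrite set11.
case/regularP=> x xN [] vx; first by rewrite vx imset_f ?orbT.
by move: vl; rewrite vx mem_level (dfs_dim ok) // andbF.
Qed.

End DepthFirst.

(** * Approximation ratio *)

Section Ratio.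
Variables (V : finType) (K : {set {set V}}).
Hypothesis K_complex : simplicial_complex K.
Implicit Types (S : {set {set V}}) (M N : {set edge V}) (x y : edge V)
  (s t u : {set V}).

Lemma matching_edge M x : matching (edges K) M -> x \in M ->
  [/\ x.1 \in K, x.2 \in K & facet x.1 x.2].
Proof.
case/matchingP=> /subsetP ME _ /ME.
by rewrite mem_edges => /and3P.
Qed.

Lemma interface_step d S M S' M' : process_interface d S M S' M' ->
  ready K d S M -> ready K d.+1 S' M'.
Proof.
rewrite /process_interface; case: eqP => [->|_] H rd.
  have [SK M0] := ready1_initial rd; move: H; rewrite SK M0.
  by case=> N HN [-> ->]; rewrite set0U; exact: dfs_ready.
have [S1 M1 mid _ s sl s0|//] := process_sound (b := d.+1) H (ready_midway rd).
exists s; rewrite // s0 /=; move: sl; rewrite mem_level => /andP[sS /eqP sd].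
have SK := valid_sub (mid_valid mid).
rewrite -sd; apply: leq_trans (card_facets K_complex (subsetP SK _ sS)).
apply/subset_leq_card/subsetP=> t; rewrite !inE => /andP[tS ->].
by rewrite (subsetP SK).
Qed.

Lemma interface_total d S M : ready K d S M ->
  exists S' M', process_interface d S M S' M'.
Proof.
move=> rd; rewrite /process_interface; case: eqP => [d1|_]; last first.
  exact: process_total (ready_midway rd).
have [N HN] := dfs_total S set0 [::] set0.
by exists (S :\: deleted (interface S 1) 1 N), (M :|: N), N.
Qed.

Lemma interfaces_sound n d ds S M M' :
  process_interfaces (iota d n ++ ds) S M M' -> ready K d S M ->
  exists S1 M1, ready K (d + n) S1 M1 /\ process_interfaces ds S1 M1 M'.
Proof.
elim: n d S M => [|n IHn] d S M /=; first by rewrite addn0; exists S, M.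
move=> H rd; rewrite addnS -addSn.
inversion H as [|d' ds' S' M1' S1 M1 M'' H1 H2]; subst.
exact: IHn H2 (interface_step H1 rd).
Qed.

Lemma interfaces_total n d S M : ready K d S M ->
  exists M', process_interfaces (iota d n) S M M'.
Proof.
elim: n d S M => [|n IHn] d S M rd /=; first by exists M; constructor.
have [S1 [M1 H1]] := interface_total rd.
have [M' H'] := IHn _ _ _ (interface_step H1 rd).
by exists M'; apply: interfaces_step H1 H'.
Qed.

Definition pairs M d := #|[set x in M | dim x.2 == d]|.

Lemma card_pairs M n : (forall x, x \in M -> dim x.2 < n) ->
  #|M| = \sum_(j < n) pairs M j.
Proof.
move=> dimM; have -> : #|M| = #|[set x in M | dim x.2 < n]|.
  by congr #|pred_of_set _|; apply/setP=> x; rewrite inE;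
    case: (boolP (x \in M)) => // /dimM.
elim: n {dimM} => [|n IHn].
  by rewrite big_ord0; apply/eqP; rewrite cards_eq0; apply/eqP/setP=> x;
    rewrite !inE ltn0 andbF.
rewrite big_ord_recr /= -IHn /pairs.
rewrite -(cardsID [set x | dim x.2 < n] [set x in M | dim x.2 < n.+1]).
congr (_ + _); congr #|pred_of_set _|; apply/setP=> x; rewrite !inE.
  by case: (x \in M) => //=; case: ltngtP; lia.
by case: (x \in M); rewrite ?andbF //=; case: ltngtP => //; lia.
Qed.

Lemma pairs0 M : matching (edges K) M -> pairs M 0 = 0.
Proof.
move=> mM; apply/eqP; rewrite cards_eq0; apply/eqP/setP=> x; rewrite !inE.
apply/negP=> /andP[/(matching_edge mM)[_ _ /facet_dim->]].
by [].
Qed.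

Lemma pairs_imset1 M d : matching (edges K) M ->
  pairs M d = #|[set x.1 | x in [set x in M | dim x.2 == d]]|.
Proof.
case/matchingP=> _ inj; rewrite card_in_imset // => x y.
rewrite !inE => /andP[xM _] /andP[yM _] xy.
by apply: inj => //; constructor 1.
Qed.

Lemma pairs_imset2 M d : matching (edges K) M ->
  pairs M d = #|[set x.2 | x in [set x in M | dim x.2 == d]]|.
Proof.
case/matchingP=> _ inj; rewrite card_in_imset // => x y.
rewrite !inE => /andP[xM _] /andP[yM _] xy.
by apply: inj => //; constructor 4.
Qed.

(** The lower ends of the pairs of [N] are distinct and covered by [M]. Each is one of at most
    [j.+2] facets of an upper end in dimension [j.+1], or is itself an upper end in dimension
    [j]. *)
Lemma pairs_covered M N j : matching (edges K) M -> matching (edges K) N ->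
  (forall t s, t \in K -> s \in K -> facet t s -> dim s = j.+1 -> covered M t) ->
  pairs N j.+1 <= j.+2 * pairs M j.+1 + pairs M j.
Proof.
move=> mM mN cov; rewrite (pairs_imset1 _ mN) [pairs M j](pairs_imset2 _ mM).
pose G := \bigcup_(x in [set x in M | dim x.2 == j.+1]) [set t in K | facet t x.2].
have cG : #|G| <= j.+2 * pairs M j.+1.
  apply: card_bigcup_leq => x; rewrite inE => /andP[/(matching_edge mM)[_ xK _]].
  by move=> /eqP <-; exact: card_facets.
apply: leq_trans (leq_add cG (leqnn _)); apply: leq_trans (leq_card_setU _ _).
apply/subset_leq_card/subsetP=> t /imsetP[y].
rewrite inE => /andP[/(matching_edge mN)[y1 y2 f] /eqP dy] tE.
have [x xM tx] := cov _ _ y1 y2 f dy; have := facet_dim f; rewrite dy -tE => -[dt].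
rewrite inE; case: tx => [tx|fx]; apply/orP; [right|left].
  apply/imsetP; exists x; last by rewrite tE.
  by rewrite inE xM -tx -tE -dt eqxx.
rewrite -tE in fx; apply/bigcupP; exists x; last by rewrite inE fx tE y1.
by rewrite inE xM (facet_dim fx) -dt eqxx.
Qed.

(** For [0 < j < n], [m j] receives [j.+1] from one term and 1 from the next, in total
    [j.+2 <= n.+1]; [m n] occurs only with [n.+1], and [m 0] at most once. *)
Lemma sum_pairs_leq (m : nat -> nat) n :
  \sum_(j < n) (j.+2 * m j.+1 + m j) <= n.+1 * \sum_(j < n.+1) m j.
Proof.
elim: n => [|n IHn]; first by rewrite big_ord0.
rewrite big_ord_recr [in leqRHS]big_ord_recr /=.
have : m n <= \sum_(j < n.+1) m j by rewrite big_ord_recr leq_addl.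
by move: IHn; set a := \sum_(j < n) _; set b := \sum_(j < n.+1) _; nia.
Qed.

Lemma low_pairs_leq n d S M N :
  ready K d S M -> n < d -> matching (edges K) N ->
  \sum_(j < n.+1) pairs N j <= n.+1 * \sum_(j < n.+1) pairs M j.
Proof.
move=> rd nd mN; apply: leq_trans (sum_pairs_leq _ _).
rewrite big_ord_recl pairs0 // add0n; apply: leq_sum => j _.
apply: pairs_covered => //; first exact: valid_matching (ready_valid rd).
move=> t s tK sK f sj; apply: (ready_covered rd tK sK f).
by rewrite sj; apply: leq_trans nd; rewrite ltnS ltn_ord.
Qed.

Lemma ready_leq D S M N : has_dim K D -> ready K D.+1 S M ->
  matching (edges K) N -> #|N| <= D.+1 * #|M|.
Proof.
move=> [_ KD] rd mN; rewrite (@card_pairs N D.+1); last first.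
  by move=> x /(matching_edge mN)[_ /KD].
rewrite (@card_pairs M D.+1); last exact: ready_dim rd.
exact: low_pairs_leq rd (leqnn _) mN.
Qed.

Lemma facet_exists s : s \in K -> 0 < dim s -> exists2 t, t \in K & facet t s.
Proof.
move=> sK ds; have /set0Pn[a as_] := simplex_neq0 K_complex sK.
have s1 : 1 < #|s| by rewrite (card_simplex K_complex sK) ltnS.
have f := facet_setD1 as_ s1; exists (s :\ a) => //.
apply: facet_subset_simplex K_complex _ _ sK _ f.
by rewrite -card_gt0; move: s1; rewrite (cardsD1 a) as_ ltnS.
Qed.

(* Otherwise the facet of s matched with maximal rank meets another facet of s
   in its partner, and the latter facet has a larger rank. *)
Lemma unmatched_facet M s : matching (edges K) M -> ranked M -> s \in K ->
  0 < dim s -> exists t, [/\ t \in K, facet t s & forall x, x \in M -> x.2 != t].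
Proof.
move=> mM [r Hr] sK ds.
case: (boolP [exists t in K, facet t s && [forall x in M, x.2 != t]]).
  by case/exists_inP=> t tK /andP[f /forall_inP]; exists t.
rewrite negb_exists_in => /forall_inP none.
have all t : t \in K -> facet t s -> exists2 x, x \in M & x.2 = t.
  move=> tK f; have := none t tK; rewrite f negb_forall_in => /exists_inP[x xM].
  by rewrite negbK => /eqP; exists x.
have [t tK f] := facet_exists sK ds; have [x xM xt] := all t tK f.
have Px : [pred x | (x \in M) && facet x.2 s] x by rewrite /= xM xt.
have [y /andP[yM fy] ymax] := @arg_maxnP _ x _ r Px.
have [y1 y2 fyy] := matching_edge mM yM.
have [t' [t'K t'y ft' ft'y]] := ridge_neq K_complex y1 sK fyy fy.
have [z zM zt'] := all t' t'K ft'.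
have := ymax z; rewrite /= zM zt' ft' => /(_ isT); rewrite leqNgt => /negP[].
by apply: Hr; rewrite ?zt' //; apply: contraNneq t'y => <-; rewrite zt'.
Qed.

(** * Consequences of a connected interface *)

Section Connected.
Variable d : nat.
Hypotheses (conn : connected (interface K d)).

Let connect_interface s t : s \in interface K d -> t \in interface K d ->
  connect (adjacent (interface K d)) s t.
Proof.
by case/andP: conn => _ /forall_inP H sI tI; exact: (forall_inP (H s sI)).
Qed.

Let top_interface s : s \in K -> dim s = d -> s \in interface K d.
Proof. by move=> sK sd; rewrite inE sK sd eqxx. Qed.

Let low_interface t : t \in K -> (dim t).+1 = d -> t \in interface K d.
Proof. by move=> tK td; rewrite inE tK td eqxx orbT. Qed.

(** Without a cofacet, [t] would be an isolated point of the interface and could not be joined to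
    [s]. *)
Lemma cofacet_exists s t : s \in K -> dim s = d -> t \in K -> (dim t).+1 = d ->
  exists2 u, u \in K & facet t u.
Proof.
move=> sK sd tK td; have := connect_interface (low_interface tK td) (top_interface sK sd).
case: (boolP [exists u in K, facet t u]) => [/exists_inP[u]|]; first by exists u.
rewrite negb_exists_in => /forall_inP none ts.
have : s = t.
  apply: (connect_stable (P := fun z => z = t)) ts _ => // c z cz cE.
  move: cz; rewrite cE => /orP[] /interface_edge[h1 h2 f h3 h4].
    by have := none z h2; rewrite f.
  by move: h4; rewrite -td => /n_Sn.
by move=> st; move: td; rewrite -st sd => /esym/n_Sn.
Qed.

(* A deleted (d-1)-simplex and a remaining one are joined by a path, on which
   some d-simplex has lost one facet and kept another. *)
Lemma small_degree_exists S M t0 s : midway K d S M ->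
  t0 \in K -> (dim t0).+1 = d -> t0 \notin S ->
  s \in level S d -> 0 < facet_degree S s ->
  exists2 s', s' \in level S d & 0 < facet_degree S s' <= d.
Proof.
move=> mid t0K t0d t0S sl /facet_degree_gt0P[t tS f].
case: (boolP [exists s' in level S d, 0 < facet_degree S s' <= d]).
  by case/exists_inP=> s'; exists s'.
rewrite negb_exists_in => /forall_inP none.
have SK := subsetP (valid_sub (mid_valid mid)).
have td : (dim t).+1 = d.
  by move: sl; rewrite mem_level -(facet_dim f) => /andP[_ /eqP].
pose P z := forall u, u \in K -> (dim u).+1 = d -> u = z \/ facet u z -> u \in S.
have low z : (dim z).+1 = d -> z \in S -> P z.
  move=> zd zS u uK ud [->//|/facet_dim fd]; exfalso; lia.
have stable c z : adjacent (interface K d) c z -> P c -> P z.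
  case/orP=> /interface_edge[cK zK fcz cd zd] Pc.
    have cS : c \in S by apply: Pc; auto.
    have zS := midway_facet mid cS zK fcz zd.
    have := none z; rewrite mem_level zS zd eqxx => /(_ isT).
    have -> /= : 0 < facet_degree S z by apply/facet_degree_gt0P; exists c.
    rewrite -ltnNge => deg u uK ud [uz|fu].
      by move: zd; rewrite -uz -ud => /n_Sn.
    (* A degree above [d] means that all of the at most [d.+1] facets of [z] remain; a missing [u]
       would lower it to [d]. *)
    apply: contraLR deg => uS; rewrite -leqNgt -ltnS -zd.
    apply: leq_trans (card_facets K_complex zK); apply: proper_card.
    apply/properP; split.
      by apply/subsetP=> v; rewrite !inE => /andP[/SK-> ->].
    by exists u; rewrite !inE ?uK ?fu // (negPf uS).
  by apply: low => //; apply: Pc; auto.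
case/negP: t0S.
have tt0 := connect_interface (low_interface (SK _ tS) td) (low_interface t0K t0d).
by apply: (connect_stable stable tt0 (low t td tS)); auto.
Qed.

End Connected.

(** An [n]-simplex cannot be both an upper end in dimension [n] and the lower end of another
    pair. *)
Lemma top_pairs_leq N n : matching (edges K) N ->
  pairs N n + pairs N n.+1 <= #|level K n|.
Proof.
move=> mN; rewrite (pairs_imset2 _ mN) (pairs_imset1 _ mN) -cardsUI.
rewrite (_ : _ :&: _ = set0) ?cards0 ?addn0.
  apply/subset_leq_card/subsetP=> t; rewrite inE mem_level.
  case/orP=> /imsetP[x]; rewrite inE => /andP[xN /eqP dx] ->;
    have [x1 x2 f] := matching_edge mN xN; first by rewrite x2 dx eqxx.
  by rewrite x1 -eqSS -(facet_dim f) dx eqxx.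
apply/setP=> t; rewrite !inE; apply/negP=> /andP[/imsetP[x]].
rewrite inE => /andP[xN /eqP dx] tx /imsetP[y].
rewrite inE => /andP[yN /eqP dy] ty; case/matchingP: (mN) => _ inj.
have xy : x = y by apply: inj => //; constructor 3; rewrite -tx.
by move: dy; rewrite -xy dx => /n_Sn.
Qed.

Lemma connected_leq n S M S' M' N : has_dim K n.+2 ->
  connected (interface K n.+2) -> ready K n.+2 S M ->
  process n.+2 S M S' M' -> matching (edges K) N -> #|N| <= n.+2 * #|M'|.
Proof.
move=> [[s0 s0K s0d] KD] conn rd H mN.
have vM := ready_valid rd; have mM := valid_matching vM.
(* Some [n]-simplex below the top is the upper end of no pair, so it can be covered only as a facet
   of an upper end. That upper end is an already deleted [n.+1]-simplex. *)
have [t0 [t0K t0d t0S]] : exists t, [/\ t \in K, (dim t).+1 = n.+2 & t \notin S].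
  have [|s sK fs] := facet_exists s0K; first by rewrite s0d.
  have sd : dim s = n.+1 by have := facet_dim fs; rewrite s0d => -[].
  have [|t [tK ft nt]] := unmatched_facet mM (valid_ranked vM) sK.
    by rewrite sd.
  have [|x xM [tx|fx]] := ready_covered rd tK sK ft; first by rewrite sd.
    by have := nt x xM; rewrite tx eqxx.
  exists x.2; have [_ x2 _] := matching_edge mM xM; split=> //.
    by rewrite (facet_dim fx) -sd (facet_dim ft).
  apply/negP=> xS; have := valid_deleted vM xS.
  by rewrite regular2.
have [|rd' MM' cnt] := process_sound (b := n.+2) H (ready_midway rd).
  move=> S1 M1 mid S1S s sl s0'; apply: small_degree_exists mid t0K t0d _ sl s0' => //.
  by apply: contra t0S; exact: (subsetP S1S).
(* Each such simplex has a cofacet by connectedness, so it is covered by [M'], and covered simplices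
   do not remain. *)
have S'0 : level S' n.+1 = set0.
  apply/setP=> t; rewrite mem_level inE; apply/negP=> /andP[tS' /eqP td].
  have tK := subsetP (valid_sub (ready_valid rd')) _ tS'.
  have [|s sK f] := cofacet_exists conn s0K s0d tK; first by rewrite td.
  have [|x xM [tx|fx]] := ready_covered rd' tK sK f.
  - by rewrite (facet_dim f) td.
  - by have := valid_deleted (ready_valid rd') tS'; rewrite tx regular2.
  - by have := valid_facet (ready_valid rd') xM tS'; rewrite fx.
have levK : #|level K n.+1| <= pairs M n.+1 + #|level S n.+1|.
  rewrite (pairs_imset2 _ mM); apply: leq_trans (leq_card_setU _ _).
  apply/subset_leq_card/subsetP=> t; rewrite mem_level inE => /andP[tK /eqP td].
  case: (ready_low rd tK); first by rewrite td.
    by move=> tS; rewrite mem_level tS td eqxx orbT.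
  case=> x xM xt; apply/orP; left; apply/imsetP; exists x => //.
  by rewrite inE xM xt td eqxx.
have cardN : #|N| = \sum_(j < n.+1) pairs N j + (pairs N n.+1 + pairs N n.+2).
  rewrite (@card_pairs N n.+3) => [|x /(matching_edge mN)[_ /KD] //].
  by rewrite big_ord_recr /= big_ord_recr /= addnA.
have cardM : #|M| = \sum_(j < n.+1) pairs M j + pairs M n.+1.
  by rewrite (card_pairs (ready_dim rd)) big_ord_recr.
(* In the names introduced below, [p <= L <= q + l], [a <= n.+1 * b] and
   [l + n.+2 * (b + q) <= n.+2 * m]; together they give [a + p <= n.+2 * m]. *)
have := low_pairs_leq rd (leqnSn _) mN; have := top_pairs_leq n.+1 mN.
move: cnt levK; rewrite S'0 cards0 cardN cardM.
move: (pairs N _ + _) (\sum_(j < n.+1) pairs N j) (\sum_(j < n.+1) pairs M j).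
move: (pairs M _) #|level K _| #|level S _| #|M'| => q L l m p a b; nia.
Qed.

End Ratio.

(** * Graphs, the case [D = 1] *)

Section Graph.
Variables (V : finType) (K : {set {set V}}).
Hypotheses (K_complex : simplicial_complex K) (K_dim : has_dim K 1).
Implicit Types (M N : {set edge V}).

(** A vertex of minimum potential is unmatched: from a matched vertex, two arcs lead over its
    partner to the other end of that edge, where the potential is smaller. *)
Lemma critical_vertex N : morse_matching K N -> #|N| < #|level K 0|.
Proof.
case/andP=> mN /no_dicycleP[f Hf]; case: K_dim => [[s sK s1] KD].
have edge01 x : x \in N -> [/\ x.1 \in level K 0, x.2 \in K, dim x.2 = 1 & facet x.1 x.2].
  case/(matching_edge mN)=> x1 x2 fx; have := KD _ x2.
  by rewrite mem_level x1 x2 (facet_dim fx) ltnS leqn0 => /eqP->.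
rewrite -(@card_in_imset _ _ fst N) => [|x y xN yN xy]; last first.
  by case/matchingP: mN => _; apply=> //; constructor 1.
apply/proper_card/properP; split.
  by apply/subsetP=> v /imsetP[x /edge01[x1 _ _ _] ->].
have [v0 v0K fv0] := facet_exists K_complex sK (eq_leq (esym s1)).
have v0l : v0 \in level K 0.
  by rewrite mem_level v0K; have := facet_dim fv0; rewrite s1 => -[<-].
have [v vl vmin] := @arg_minnP _ v0 (mem (level K 0)) f v0l.
exists v => //; apply/imsetP=> [[x xN vx]].
have [_ x2 d2 fx] := edge01 x xN.
have vK : v \in K by move: vl; rewrite inE mem_level => /andP[].
rewrite -vx in fx; have [w [wK wv fw]] := facet_neq K_complex vK x2 fx.
have wl : w \in level K 0.
  by rewrite mem_level wK; have := facet_dim fw; rewrite d2 => -[<-].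
have := vmin w wl; rewrite leqNgt => /negP[].
have [NE inj] := matchingP _ _ mN.
have wxN : (w, x.2) \notin N.
  apply: contra wv => wxN; rewrite vx.
  by rewrite -(inj _ _ wxN xN) //; constructor 4.
apply: (@ltn_trans (f x.2)); apply: Hf; rewrite /darc /= in_setI in_setD.
  by rewrite wxN [(w, _) \in _]mem_edges /= wK x2 fw orbT.
by rewrite vx -surjective_pairing xN (subsetP NE).
Qed.

Lemma graph_leq M N : connected (interface K 1) ->
  process_interfaces [:: 1] K set0 M -> morse_matching K N -> #|N| <= #|M|.
Proof.
move=> conn H mN; inversion H as [|d ds S M' S1 M1 M'' H1 H2]; subst.
inversion H2; subst; case: H1 => M1 HM [_ ->]; rewrite set0U -ltnS.
apply: leq_trans (critical_vertex mN) _.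
exact: dfs_spanning conn HM.
Qed.

End Graph.

Lemma OPT_leq (V : finType) (K : {set {set V}}) (M : {set edge V}) c :
  matching (edges K) M ->
  (forall N : {set edge V}, morse_matching K N -> #|N| <= c * #|M|) ->
  OPT K <= c * #|regular M|.
Proof.
have ne N : matching (edges K) N -> forall x, x \in N -> x.1 != x.2.
  move=> mN x /(matching_edge mN)[_ _ /facet_dim dx].
  by apply/eqP=> xx; move: dx; rewrite -xx => /n_Sn.
move=> mM H; apply/bigmax_leqP => N morseN.
have [mN _] := andP morseN.
rewrite (card_regular mN (ne _ mN)) (card_regular mM (ne _ mM)) mulnA.
by rewrite leq_mul2r H.
Qed.

Lemma ratio_le (R : numFieldType) c a b : a <= c * b ->
  (1 / c%:R * a%:R <= b%:R :> R)%R.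
Proof.
(* For [c = 0] the inverse is 0 by convention and the left side vanishes. *)
case: c => [|c] h; first by rewrite invr0 mulr0 mul0r ler0n.
by rewrite mul1r mulrC ler_pdivrMr ?ltr0n // -natrM ler_nat mulnC.
Qed.

Unset Implicit Arguments.
Set Strict Implicit.
Set Printing Implicit Defensive.

Local Open Scope ring_scope.

Theorem mainTheorem4 (V : finType) (K : {set {set V}}) (D : nat)
    (K_complex : simplicial_complex K) (K_dim : has_dim K D) :
  (exists M : {set edge V}, min_facet_algorithm K D M) /\
  (forall M : {set edge V}, min_facet_algorithm K D M ->
     morse_matching K M /\
     (connected (interface K D) ->
        1 / D%:R * (OPT K)%:R <= (#|regular M|)%:R :> rat) /\
     (~~ connected (interface K D) ->
        1 / D.+1%:R * (OPT K)%:R <= (#|regular M|)%:R :> rat)).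
Proof.
have start := ready1 K; split; first exact: interfaces_total start.
move=> M H; have [S rd] : exists S, ready K D.+1 S M.
  have H' : process_interfaces (iota 1 D ++ [::]) K set0 M by rewrite cats0.
  have [S [M1 [rd HM]]] := interfaces_sound K_complex H' start.
  by inversion HM; subst; exists S.
have mM := valid_matching (ready_valid rd); split.
  rewrite /morse_matching mM; apply: ranked_no_dicycle mM _ _.
    by move=> x; rewrite mem_edges => /and3P[].
  exact: valid_ranked (ready_valid rd).
split=> [conn|_]; apply: ratio_le; apply: OPT_leq => // N morseN;
  have [mN _] := andP morseN; last by have := ready_leq K_complex K_dim rd mN.
case: D K_dim H conn {rd} => [|[|n]] K_dim H conn.
(* For [D = 0] there are no Hasse edges, so [N] is empty. *)
- case: K_dim => _ KD; rewrite mul0n leqn0 cards_eq0; apply/eqP/setP=> x.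
  rewrite inE; apply/negP=> /(matching_edge mN)[_ /KD + f].
  by rewrite (facet_dim f).
- by rewrite mul1n; have := graph_leq K_complex K_dim conn H morseN.
(* The top interface is split off, since the sharper count concerns it alone. *)
have H' : process_interfaces (iota 1 n.+1 ++ [:: n.+2]) K set0 M.
  by rewrite -(iotaD 1 n.+1 1) addn1.
have [S1 [M1 [rd1 HM]]] := interfaces_sound K_complex H' start.
inversion HM as [|d ds S0 M0 S2 M2 M3 HP HS]; subst; inversion HS; subst.
by have := connected_leq K_complex K_dim conn rd1 HP mN.
Qed.
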